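(* Let $p$ be an odd prime, let $\mu=\pm1$, and let $k,\ell,r_1,r_2\in\mathbb Z$ with $k>\ell>0$, $p^{k-\ell}\equiv-\mu\pmod 4$, and $r_1,r_2\ge0$. Then $$\Sigma(p^k,\mu p^\ell;p^{r_1},p^{r_2})=\sum_{i=0}^{\ell}g(p^i,p^i,p^i)\,g(p^{\ell-i},p^{r_2},p^{\ell-i})\,g(p^k,p^{r_1+\ell-i},p^k).$$
   Context: $(\frac{\cdot}{\cdot})$ is the Kronecker symbol; for nonzero reals $(x,y)_{\mathbb R}=-1$ if $x,y<0$ and $1$ otherwise. Gauss sums: $g(d,m,n)=\sum_{x\in(\mathbb Z/n\mathbb Z)^\times}(\frac{x}{d})e^{2\pi i mx/n}$ (with $g(1,m,1)=1$). $\Gamma=\Gamma_1(4)$ is the group of $\gamma\in\mathrm{SL}(3,\mathbb Z)$ congruent mod $4$ to an upper triangular unipotent matrix, and $\Gamma_\infty$ is the group of upper triangular unipotent matrices in $\mathrm{SL}(3,\mathbb Z)$. The Plücker coordinates of a matrix with second row $(d,e,f)$ and third row $(g,h,i)$ are $(-g,-h,-i,-(dh-eg),di-fg,-(ei-fh))$; for $\gamma\in\Gamma$ they are written $(4A_1,4B_1,C_1,4A_2,4B_2,C_2)$ with integers $A_i,B_i,C_i$ (they satisfy $A_1C_2+4B_1B_2+C_1A_2=0$, $\gcd(A_i,B_i,C_i)=1$, $C_i\equiv-1$ mod $4$, and such tuples parametrize $\Gamma_\infty\backslash\Gamma$). Splitting: $s:\Gamma\to\{\pm1\}$ is the function such that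 $\gamma\mapsto(\gamma,s(\gamma))$ is Miller's splitting homomorphism of $\Gamma$ into the double cover of $\mathrm{SL}(3,\mathbb R)$; it is left and right $\Gamma_\infty$-invariant and for $A_1,A_2\neq0$ it is determined as follows. If $A_1>0$ and $A_2/D$ is odd, with $D=\gcd(A_1,A_2)$, $D_1=\gcd(D,B_1)$, $D_2=D/D_1$, $\epsilon=(\frac{-1}{B_1/D_1})$, then $$s(\gamma)=\Big(\tfrac{\epsilon}{-A_1A_2}\Big)\Big(\tfrac{A_1/D}{A_2/D}\Big)\Big(\tfrac{B_1/D_1}{A_1/D}\Big)\Big(\tfrac{4B_2/D_2}{|A_2|/D}\Big)\Big(\tfrac{D_1}{C_1}\Big)\Big(\tfrac{D_2}{C_2}\Big);$$ the remaining cases follow from $s(S_3\gamma S_3)=s(\gamma)$ with $S_3=\mathrm{diag}(1,1,-1)$, and $s(w_\ell{}^\intercal\gamma^{-1}w_\ell^{-1})=(-A_1,-A_2)_{\mathbb R}s(\gamma)$ with $w_\ell=\begin{pmatrix}0&0&1\\0&-1&0\\1&0&0\end{pmatrix}$. Exponential sums: for nonzero integers $A_1,A_2$, $\mathbb S(A_1,A_2)$ is the set of $\gamma\in\Gamma$ with Plücker coordinates $(4A_1,*,*,4A_2,*,* )$, and $\Sigma(A_1,A_2;m_1,m_2)=\sum_{\gamma\in\Gamma_\infty\backslash\mathbb S(A_1,A_2)/\Gamma_\infty}s(\gamma)e^{2\pi i(m_1\frac{B_1}{A_1}+m_2\frac{B_2}{A_2})}$ for $m_1,m_2\in\mathbb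 Z$. *)

(* Defs.v *)
From HB Require Import structures.
From mathcomp Require Import all_boot all_order all_algebra.
From mathcomp Require Import complex.
From mathcomp Require Import all_classical all_reals all_analysis.

Set Implicit Arguments.
Unset Strict Implicit.
Unset Printing Implicit Defensive.
Import Order.TTheory GRing.Theory Num.Theory.

Local Open Scope ring_scope.
Local Open Scope complex_scope.
Local Open Scope classical_set_scope.

(* The factor (a / q) of the Kronecker symbol, for q a prime number. *)
Definition kronecker_prime (a : int) (q : nat) : int :=
  if (q%:Z %| a)%Z then 0
  else if q == 2 then
    (if ((a %% 8)%Z == 1) || ((a %% 8)%Z == 7) then 1 else -1)
  else if [exists x : 'I_q, (x%:Z ^+ 2 == a %[mod q%:Z])%Z] then 1 else -1.

(* (a / n) for arbitrary integers: (a / 0) = 1 iff a = 1 or -1, and the sign of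
   n contributes (a / -1), which is -1 exactly when a < 0. *)
Definition kronecker (a n : int) : int :=
  if n == 0 then (`|a|%N == 1)%:R
  else (if (n < 0) && (a < 0) then -1 else 1)
       * \prod_(q <- primes `|n|) kronecker_prime a q ^+ logn q `|n|.

Definition hilbert_real (K : numDomainType) (x y : K) : int :=
  if (x < 0) && (y < 0) then -1 else 1.

(* e^{2 pi i t} *)
Definition expi2pi (R : realType) (t : R) : R[i] :=
  cos (2 * pi * t) +i* sin (2 * pi * t).

(* The units modulo n are represented by the 0 <= x < n prime to n; for n = 1
   this is x = 0, so that gauss_sum R 1 m 1 = 1. *)
Definition gauss_sum (R : realType) (d m : int) (n : nat) : R[i] :=
  \sum_(x < n | coprime x n)
    (kronecker x%:Z d)%:~R * expi2pi ((m * x%:Z)%:~R / n%:R : R).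

(* Rows and columns are numbered from 0, so the second and third rows
   (d, e, f) and (g, h, i) of M are rows 1 and 2. *)
Definition Gamma_inf : set 'M[int]_3 :=
  [set M | forall i j : 'I_3, (j <= i)%N -> M i j = (i == j)%:R].

Definition Gamma : set 'M[int]_3 :=
  [set M | \det M = 1 /\
           forall i j : 'I_3, (j <= i)%N -> (M i j = (i == j)%:R %[mod 4])%Z].

(* Pluecker coordinates (4 A_1, 4 B_1, C_1, 4 A_2, 4 B_2, C_2); the divisions
   by 4 are exact for M in Gamma. *)
Definition plA1 (M : 'M[int]_3) : int := ((- M 2 0)%R %/ 4)%Z.
Definition plB1 (M : 'M[int]_3) : int := ((- M 2 1)%R %/ 4)%Z.
Definition plC1 (M : 'M[int]_3) : int := - M 2 2.
Definition plA2 (M : 'M[int]_3) : int :=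
  ((- (M 1 0 * M 2 1 - M 1 1 * M 2 0))%R %/ 4)%Z.
Definition plB2 (M : 'M[int]_3) : int :=
  ((M 1 0 * M 2 2 - M 1 2 * M 2 0)%R %/ 4)%Z.
Definition plC2 (M : 'M[int]_3) : int :=
  - (M 1 1 * M 2 2 - M 1 2 * M 2 1).

(* The closed formula for the splitting, valid for A_1 > 0 and A_2 / D odd.
   The relation A_1 C_2 + 4 B_1 B_2 + C_1 A_2 = 0 makes every quotient exact;
   in particular D_2 divides 4 B_2. *)
Definition splitting_formula (M : 'M[int]_3) : int :=
  let A1 := plA1 M in let B1 := plB1 M in let C1 := plC1 M in
  let A2 := plA2 M in let B2 := plB2 M in let C2 := plC2 M in
  let D := gcdz A1 A2 in
  let D1 := gcdz D B1 in
  let D2 := (D %/ D1)%Z in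
  let eps := kronecker (-1) (B1 %/ D1)%Z in
  kronecker eps (- (A1 * A2))
  * kronecker (A1 %/ D)%Z (A2 %/ D)%Z
  * kronecker (B1 %/ D1)%Z (A1 %/ D)%Z
  * kronecker (4 * B2 %/ D2)%Z (`|A2| %/ D)%Z
  * kronecker D1 C1
  * kronecker D2 C2.

Definition S3 : 'M[int]_3 :=
  \matrix_(i, j) (if i == j then (if i == 2 then -1 else 1) else 0).

Definition w_long : 'M[int]_3 :=
  \matrix_(i, j) (if (i + j == 2)%N then (-1) ^+ i else 0).

(* Conjugation by S_3 negates A_1, B_1 and A_2 and fixes the other
   coordinates, so it reduces A_1 < 0 to A_1 > 0. *)
Definition splitting_odd (M : 'M[int]_3) : int :=
  if 0 < plA1 M then splitting_formula M else splitting_formula (S3 *m M *m S3).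

(* The splitting s on the elements of Gamma with A_1 and A_2 nonzero (elsewhere
   the value is irrelevant). The involution M |-> w M^-T w^-1 maps (A_1, B_1,
   C_1, A_2, B_2, C_2) to (A_2, -B_2, C_2, A_1, -B_1, C_1); when A_2 / D is
   even, A_1 / D is odd, and it reduces to the case where A_2 / D is odd. *)
Definition splitting (M : 'M[int]_3) : int :=
  if odd `|(plA2 M %/ gcdz (plA1 M) (plA2 M))%Z|%N then splitting_odd M
  else hilbert_real (- plA1 M) (- plA2 M)
       * splitting_odd (w_long *m (invmx M)^T *m invmx w_long).

Definition bigS (A1 A2 : int) : set 'M[int]_3 :=
  [set M | Gamma M /\ plA1 M = A1 /\ plA2 M = A2].

Definition dcoset (M : 'M[int]_3) : set 'M[int]_3 :=
  [set N | exists u v, [/\ Gamma_inf u, Gamma_inf v & N = u *m M *m v]].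

Definition Sigma_term (R : realType) (m1 m2 : int) (M : 'M[int]_3) : R[i] :=
  (splitting M)%:~R
  * expi2pi (m1%:~R * ((plB1 M)%:~R / (plA1 M)%:~R)
             + m2%:~R * ((plB2 M)%:~R / (plA2 M)%:~R) : R).

(* The sum runs over the set of double cosets X, which is finite for A1 and A2
   nonzero; the summand does not depend on the representative of X, here
   selected by [xget]. *)
Definition Sigma (R : realType) (A1 A2 m1 m2 : int) : R[i] :=
  \sum_(X \in [set dcoset M | M in bigS A1 A2]) Sigma_term R m1 m2 (xget 1%:M X).

(* Main.v *)
Require Import Defs.
From mathcomp Require Import all_boot all_order all_algebra.
From mathcomp Require Import all_solvable all_field.
From mathcomp Require Import complex.
From mathcomp Require Import all_classical all_reals all_analysis.
From mathcomp Require Import ring zify.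
Import Order.TTheory GRing.Theory Num.Theory.
Local Open Scope ring_scope.

(** Write [chi] for the Legendre symbol modulo [p]. Primitivity and the relation
    between the Pluecker coordinates force [B_1 = p^i x] and [B_2 = p^(l-i) y]
    with [0 <= i <= l], [x] prime to [p], [y] prime to [p] if [i > 0], and [C_2]
    prime to [p] if [i < l]. By quadratic reciprocity in the form
    [(p / C) = chi (- C)] for [C = -1 mod 4], and because
    [- C_1 = 4 mu x y mod p], the splitting equals
    [chi(x)^(k-l) chi(mu x y)^i chi(- C_2)^(l-i)].
    The double cosets correspond to the quadruples formed by [i] and the classes
    of [x] mod [p^(k-i)], [y] mod [p^i] and [c] mod [p^l], where [C_2 = 4 c - 1],
    so the [i]-th part of the sum factors. With [j = l - i], the sum over [c] is
    [p^i] times the Gauss sum with index [j] and frequency [p^j], which vanishes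
    for odd [j]; for even [j] the character [chi^(k-l+i)] in the sum over [x] is
    [chi^k], and the factor [p^i] lifts this sum from modulus [p^(k-i)] to [p^k]. *)

(** * The Legendre symbol modulo an odd prime, by way of Euler's criterion *)

Lemma intr_Fp_eq0 (p : nat) (a : int) :
  prime p -> (a%:~R == 0 :> 'F_p) = (p%:Z %| a)%Z.
Proof.
move=> p_pr; have chF := pchar_Fp p_pr.
have Hn (n : nat) : (n%:R == 0 :> 'F_p) = (p%:Z %| n%:Z)%Z.
  by rewrite -(dvdn_pcharf chF).
case: a => n; first exact: Hn.
by rewrite NegzE mulrNz oppr_eq0 dvdzE abszN -[RHS]/(p%:Z %| n.+1%:Z)%Z -Hn.
Qed.

Lemma Fp_expf_card (p : nat) (x : 'F_p) :
  prime p -> odd p -> x != 0 -> (x ^+ p./2) ^+ 2 = 1.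
Proof.
move=> p_pr p_odd x0; rewrite -exprM muln2.
have E : (p./2).*2.+1 = p by have := odd_double_half p; rewrite p_odd.
have H : x ^+ (p./2).*2.+1 = x by rewrite E -[RHS]expf_card card_Fp.
by apply: (mulfI x0); rewrite mulr1 -exprS.
Qed.

(** As [p] is odd, [p./2] is [(p - 1) / 2]. Write [a = z ^+ i] with [z] a primitive root: if the
    power of [a] is 1, then [p - 1] divides [i * p./2], so [i] is even. *)
Lemma Fp_euler_criterion (p : nat) (a : 'F_p) :
  prime p -> odd p -> a != 0 -> (exists b, b ^+ 2 = a) <-> a ^+ p./2 = 1.
Proof.
move=> p_pr p_odd a0; split=> [[b ba]|a1].
  rewrite -ba exprAC Fp_expf_card //.
  by apply: contraNneq a0 => b0; rewrite -ba b0 expr0n.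
have E : (p./2).*2.+1 = p by have := odd_double_half p; rewrite p_odd.
have n0 : (0 < (p./2).*2)%N by move: (prime_gt1 p_pr); lia.
(* The nonzero elements are [p - 1] distinct roots of [X ^ (p - 1) - 1], so one of them is a
   primitive root. *)
pose rs := [seq x <- enum 'F_p | x != 0].
have rs1 : all (p./2).*2.-unity_root rs.
  apply/allP => x; rewrite mem_filter => /andP[x0 _].
  by apply/unity_rootP; rewrite -muln2 exprM Fp_expf_card.
have rsu : uniq rs by rewrite filter_uniq // enum_uniq.
have rss : ((p./2).*2 <= size rs)%N.
  have := count_predC (fun x : 'F_p => x != 0) (enum 'F_p).
  have -> : size (enum 'F_p) = p by rewrite -cardE card_Fp.
  rewrite -size_filter -/rs => Hs.
  have : (count (predC (fun x : 'F_p => x != 0%R)) (enum 'F_p) <= 1)%N.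
    rewrite -size_filter -[1%N]/(size [:: 0%R : 'F_p]).
    apply: uniq_leq_size; first by rewrite filter_uniq // enum_uniq.
    by move=> x; rewrite mem_filter /= negbK inE => /andP[/eqP -> _].
  move=> H1; have : (p <= size rs + 1)%N by rewrite -[X in (X <= _)%N]Hs leq_add2l.
  by rewrite -[X in (X <= _)%N]E addn1 ltnS.
have /hasP[z _ zprim] := has_prim_root n0 rs1 rsu rss.
have [i ai] : exists i : nat, a = z ^+ i.
  have : a ^+ (p./2).*2 = 1 by rewrite -muln2 exprM Fp_expf_card.
  by case/(prim_rootP zprim) => i ->; exists i.
move: a1; rewrite ai -exprM => /eqP; rewrite -(prim_order_dvd zprim).
rewrite -mul2n dvdn_pmul2r; last by move: n0; lia.
case/dvdnP => j ->; exists (z ^+ j); by rewrite -exprM.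
Qed.

Lemma kronecker_prime_Fp (p : nat) (a : int) :
  prime p -> odd p ->
  (kronecker_prime a p)%:~R = a%:~R ^+ p./2 :> 'F_p.
Proof.
move=> p_pr p_odd; rewrite /kronecker_prime -intr_Fp_eq0 //.
case: eqP => [->|/eqP a0].
  by rewrite expr0n; case: (p) p_pr p_odd => [|[|[|n]]].
have -> : (p == 2) = false by apply/negP => /eqP p2; rewrite p2 in p_odd.
have Hex : [exists x : 'I_p, (x%:Z ^+ 2 == a %[mod p%:Z])%Z]
    <-> exists b : 'F_p, b ^+ 2 = a%:~R.
  split=> [/existsP[x]|[b ba]].
    rewrite eqz_mod_dvd -intr_Fp_eq0 // rmorphB /= subr_eq0 rmorphXn /= => /eqP H.
    by exists x%:~R.
  have bp : (b < p)%N by rewrite -[X in (_ < X)%N](Fp_cast p_pr) ltn_ord.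
  apply/existsP; exists (Ordinal bp).
  rewrite eqz_mod_dvd -intr_Fp_eq0 // rmorphB /= subr_eq0 rmorphXn /=.
  by rewrite -ba -[b in X in _ == X]natr_Zp.
have sq := Fp_expf_card p (a%:~R) p_pr p_odd a0.
have /pred2P[a1|a1] : ((a%:~R : 'F_p) ^+ p./2 == 1) || ((a%:~R : 'F_p) ^+ p./2 == -1).
  by rewrite -sqrf_eq1; apply/eqP.
  rewrite ifT ?a1 //; apply: Hex.2.
  exact: (Fp_euler_criterion p _ p_pr p_odd a0).2.
rewrite ifF ?a1 //; apply/negbTE/negP => Hx; have := (Fp_euler_criterion p _ p_pr p_odd a0).1 (Hex.1 Hx).
rewrite a1 => /eqP; rewrite -subr_eq0 -opprD oppr_eq0.
rewrite -(natrD _ 1 1) -(dvdn_pcharf (pchar_Fp p_pr)) dvdn_prime2 // => /eqP p2.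
by rewrite p2 in p_odd.
Qed.

Lemma kronecker_prime_cases (p : nat) (a : int) :
  [\/ kronecker_prime a p = 0, kronecker_prime a p = 1 |
      kronecker_prime a p = -1].
Proof.
rewrite /kronecker_prime; do !case: ifP => _; by [constructor 1|constructor 2|constructor 3].
Qed.

Lemma kronecker_prime_eq0 (p : nat) (a : int) :
  (kronecker_prime a p == 0) = (p%:Z %| a)%Z.
Proof. by rewrite /kronecker_prime; do !case: ifP => //. Qed.

(** The difference is at most 2 in absolute value and [p >= 3]. Identities between symbols can
    therefore be checked in ['F_p], where Euler's criterion turns them into identities of powers. *)
Lemma Fp_inj_sign (p : nat) (a b : int) : prime p -> odd p ->
  a%:~R = b%:~R :> 'F_p -> `|a| <= 1 -> `|b| <= 1 -> a = b.
Proof.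
move=> p_pr p_odd /eqP; rewrite -subr_eq0 -rmorphB /= intr_Fp_eq0 //.
move=> /dvdzP[q E] a1 b1.
have p3 : (3 <= p)%N by case: (p) p_pr p_odd => [|[|[|n]]].
by case: (ltrgt0P q) E => [q0|q0|->] E; nia.
Qed.

Lemma kronecker_prime_le1 (p : nat) (a : int) : `|kronecker_prime a p| <= 1.
Proof. by case: (kronecker_prime_cases p a) => ->. Qed.

Lemma kronecker_primeM (p : nat) (a b : int) : prime p -> odd p ->
  kronecker_prime (a * b) p = kronecker_prime a p * kronecker_prime b p.
Proof.
move=> p_pr p_odd; apply: (@Fp_inj_sign p) => //.
- by rewrite rmorphM /= !kronecker_prime_Fp // rmorphM exprMn.
- exact: kronecker_prime_le1.
- by rewrite normrM mulr_ile1 // kronecker_prime_le1.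
Qed.

Lemma kronecker_prime1 (p : nat) : prime p -> kronecker_prime 1 p = 1.
Proof.
move=> p_pr; rewrite /kronecker_prime dvdz1 absz_nat.
rewrite ifF; last by apply/negP => /eqP p1; move: p_pr; rewrite p1.
case: ifP => // p2; rewrite ifT //; apply/existsP.
by exists (Ordinal (prime_gt1 p_pr)).
Qed.

Lemma kronecker_primeX (p n : nat) (a : int) : prime p -> odd p ->
  kronecker_prime (a ^+ n) p = kronecker_prime a p ^+ n.
Proof.
move=> p_pr p_odd; elim: n => [|n IH]; first by rewrite !expr0 kronecker_prime1.
by rewrite !exprS kronecker_primeM // IH.
Qed.

Lemma kronecker_prime_mod (p : nat) (a b : int) : prime p -> odd p ->
  (p%:Z %| a - b)%Z -> kronecker_prime a p = kronecker_prime b p.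
Proof.
move=> p_pr p_odd; rewrite -intr_Fp_eq0 // rmorphB /= subr_eq0 => /eqP ab.
apply: (@Fp_inj_sign p) => //; try exact: kronecker_prime_le1.
by rewrite !kronecker_prime_Fp // ab.
Qed.

(** Otherwise squaring would be onto, hence injective on a finite field; but 1 and -1 have the same
    square. *)
Lemma kronecker_prime_nonresidue (p : nat) : prime p -> odd p ->
  exists a : int, kronecker_prime a p = -1.
Proof.
move=> p_pr p_odd; apply: contrapT => H.
have surj (x : 'F_p) : exists b, b ^+ 2 = x.
  have [->|x0] := eqVneq x 0; first by exists 0; rewrite expr0n.
  apply/(Fp_euler_criterion p) => //.
  rewrite -[x]natr_Zp pmulrn -kronecker_prime_Fp //.
  case: (kronecker_prime_cases p (nat_of_ord x)) => [|->//|] E; last by case: H; exists (x : nat).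
  by move/eqP: E; rewrite kronecker_prime_eq0 -intr_Fp_eq0 // -pmulrn natr_Zp (negbTE x0).
have [g gK] := choice surj.
have ginj : injective g by apply: (can_inj (g := fun b => b ^+ 2)).
have [g' _ g'K] := injF_bij ginj.
have sqinj (b c : 'F_p) : b ^+ 2 = c ^+ 2 -> b = c.
  by rewrite -[b]g'K -[c]g'K !gK => ->.
have /eqP := sqinj 1 (-1) (esym (sqrrN 1)).
rewrite -subr_eq0 opprK -(natrD _ 1 1) -(dvdn_pcharf (pchar_Fp p_pr)) dvdn_prime2 //.
by move=> /eqP p2; rewrite p2 in p_odd.
Qed.

(** * Quadratic Gauss sums over a field and quadratic reciprocity *)

(** The values are integers, so that they can be cast into a field of any characteristic. *)
Definition Fp_char (q : nat) (x : 'F_q) : int := kronecker_prime (x : nat) q.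

Lemma Fp_char_intr (q : nat) (a : int) : prime q -> odd q ->
  Fp_char q a%:~R = kronecker_prime a q.
Proof.
move=> q_pr q_odd; apply: kronecker_prime_mod => //.
by rewrite -intr_Fp_eq0 // rmorphB /= subr_eq0 -pmulrn natr_Zp.
Qed.

Lemma Fp_charM (q : nat) : prime q -> odd q ->
  {morph Fp_char q : x y / x * y}.
Proof.
move=> q_pr q_odd x y; rewrite -{1}[x]natr_Zp -{1}[y]natr_Zp !pmulrn -rmorphM.
by rewrite Fp_char_intr // kronecker_primeM.
Qed.

Lemma Fp_char_eq0 (q : nat) (x : 'F_q) : prime q ->
  (Fp_char q x == 0) = (x == 0).
Proof.
by move=> q_pr; rewrite kronecker_prime_eq0 -intr_Fp_eq0 // -pmulrn natr_Zp.
Qed.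

Lemma Fp_char_sqr (q : nat) (x : 'F_q) : prime q -> x != 0 ->
  Fp_char q x * Fp_char q x = 1.
Proof.
move=> q_pr; rewrite -Fp_char_eq0 // /Fp_char.
by case: (kronecker_prime_cases q (nat_of_ord x)) => ->.
Qed.

(** Multiplication by a nonresidue permutes the terms and changes their signs. *)
Lemma Fp_char_sum (q : nat) : prime q -> odd q -> \sum_x Fp_char q x = 0.
Proof.
move=> q_pr q_odd; have [a Ea] := kronecker_prime_nonresidue q q_pr q_odd.
have a0 : (a%:~R : 'F_q) != 0.
  by rewrite intr_Fp_eq0 // -(kronecker_prime_eq0 q) Ea.
have : \sum_x Fp_char q x = - \sum_x Fp_char q x.
  rewrite {1}(reindex_inj (mulfI a0)) -sumrN; apply: eq_bigr => x _.
  by rewrite Fp_charM // Fp_char_intr // Ea mulN1r.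
lia.
Qed.

Lemma kronecker_primeN1 (q : nat) : prime q -> odd q ->
  kronecker_prime (-1) q = (-1) ^+ q./2.
Proof.
move=> q_pr q_odd; apply: (@Fp_inj_sign q) => //.
- by rewrite kronecker_prime_Fp // !rmorphXn /= rmorphN1.
- exact: kronecker_prime_le1.
- by rewrite normrX normrN1 expr1n.
Qed.

Section GaussSum.
Variables (K : fieldType) (q : nat) (z : K).
Hypotheses (q_pr : prime q) (q_odd : odd q) (zq : z ^+ q = 1) (z1 : z != 1).

Let psi (x : 'F_q) : K := z ^+ x.
Let chi (x : 'F_q) : K := (Fp_char q x)%:~R.

Let psi_nat (n : nat) : psi n%:R = z ^+ n.
Proof.
rewrite /psi -[in RHS](expr_mod _ zq); congr (_ ^+ _).
by rewrite val_Fp_nat.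
Qed.

Let psiD x y : psi (x + y) = psi x * psi y.
Proof. by rewrite -{1}[x]natr_Zp -{1}[y]natr_Zp -natrD psi_nat exprD. Qed.

(** Translation by 1 multiplies the sum by [z], which is not 1. *)
Let psi_sum (u : 'F_q) : u != 0 -> \sum_x psi (u * x) = 0.
Proof.
move=> u0; have <- : \sum_x psi x = \sum_x psi (u * x).
  by rewrite (reindex_inj (mulfI u0)).
have H : z * \sum_x psi x = \sum_x psi x.
  rewrite [in RHS](reindex_inj (addrI 1)) big_distrr /=.
  by apply: eq_bigr => x _; rewrite psiD (psi_nat 1).
apply/eqP; have : (z - 1) * \sum_x psi x == 0 by rewrite mulrBl H mul1r subrr.
by rewrite mulf_eq0 subr_eq0 (negbTE z1).
Qed.

(** In the double sum over [x] and [y], put [y = x * t]: the character of [x] cancels. The remaining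
    sum over nonzero [x] is [q - 1] for [t = -1] and -1 for any other [t]; as the values of [chi]
    sum to 0, only [chi (-1) * q] survives. *)
Lemma legendre_gauss_sum_sqr :
  (\sum_x chi x * psi x) ^+ 2 = (kronecker_prime (-1) q * q%:Z)%:~R.
Proof.
have chi_sum : \sum_x chi x = 0.
  by rewrite -(rmorph_sum (intmul (1 : K))) /= Fp_char_sum // mulr0z.
have step1 : (\sum_x chi x * psi x) ^+ 2 =
    \sum_(x | x != 0) \sum_t chi t * psi (x * (1 + t)).
  rewrite expr2 big_distrl /= (bigD1 0) //= [chi 0](_ : _ = 0); last first.
    by rewrite /chi (eqP (_ : Fp_char q 0 == 0)) ?Fp_char_eq0.
  rewrite mul0r mul0r add0r; apply: eq_bigr => x x0.
  rewrite (reindex_inj (mulfI x0)) /= big_distrr /=; apply: eq_bigr => t _.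
  rewrite mulrDr mulr1 psiD /chi Fp_charM // rmorphM /=.
  rewrite mulrACA !mulrA -rmorphM /= Fp_char_sqr // mul1r.
  by rewrite -mulrA.
rewrite step1 exchange_big /=.
have inner (t : 'F_q) : \sum_(x | x != 0) chi t * psi (x * (1 + t)) =
    chi t * ((if t == -1 then q%:R else 0) - 1).
  rewrite -big_distrr /=; congr (_ * _).
  have -> : \sum_(x : 'F_q | x != 0) psi (x * (1 + t)) =
      \sum_(x : 'F_q) psi ((1 + t) * x) - 1.
    rewrite [X in _ = X - 1](bigD1 0) //= mulr0 addrAC /psi expr0 subrr add0r.
    by apply: eq_bigr => x _; rewrite mulrC.
  congr (_ - _); case: eqP => [->|/eqP t1].
    rewrite subrr (eq_bigr (fun=> 1)) => [|x _]; last by rewrite mul0r /psi expr0.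
    by rewrite sumr_const card_Fp.
  by rewrite psi_sum // addrC -[1]opprK subr_eq0.
rewrite (eq_bigr _ (fun t _ => inner t)).
under eq_bigr do rewrite mulrBr mulr1.
rewrite sumrB chi_sum subr0 (bigD1 (-1)) //= eqxx big1 => [|t /negbTE->]; last by rewrite mulr0.
rewrite addr0 /chi (_ : -1 = (-1)%:~R :> 'F_q); last by rewrite rmorphN1.
by rewrite Fp_char_intr // rmorphM.
Qed.

(** Frobenius is additive, fixes the integers [chi x] and sends [psi x] to [psi (p * x)]; the
    substitution of [p * x] for [x] then costs a factor [chi p]. *)
Lemma legendre_gauss_sum_expp (p : nat) : p \in [pchar K] -> odd p ->
  (p%:R : 'F_q) != 0 ->
  (\sum_x chi x * psi x) ^+ p = (kronecker_prime p%:Z q)%:~R * \sum_x chi x * psi x.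
Proof.
move=> chp p_odd p0; rewrite -(pFrobenius_autE chp) rmorph_sum /=.
rewrite [in RHS](reindex_inj (mulfI p0)) big_distrr /=; apply: eq_bigr => x _.
rewrite rmorphM /= [psi (_ * _)](_ : _ = pFrobenius_aut chp (psi x)); last first.
  by rewrite -{1}[x]natr_Zp -natrM psi_nat pFrobenius_autE /psi -exprM mulnC.
rewrite mulrA; congr (_ * _).
rewrite /chi Fp_charM // -Fp_char_intr // -pmulrn -rmorphM mulrA Fp_char_sqr //.
rewrite mul1r rmorph_int //.
Qed.
End GaussSum.

(** Let [G] be the Gauss sum modulo [q] in an algebraic closure of ['F_p]. Frobenius gives [G ^+ p]
    as [(p / q)] times [G], while [G ^+ (p - 1)] is the power [p./2] of [G ^+ 2], which Euler's
    criterion identifies with the symbol of [G ^+ 2] modulo [p]. *)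
Lemma kronecker_prime_reciprocity_distinct (p q : nat) :
  prime p -> odd p -> prime q -> odd q -> p != q ->
  kronecker_prime p%:Z q = kronecker_prime (kronecker_prime (-1) q * q%:Z) p.
Proof.
move=> p_pr p_odd q_pr q_odd pq.
have [K [f _]] := countable_algebraic_closure 'F_p.
have chK : p \in [pchar K] by rewrite (fmorph_pchar f) pchar_Fp.
have q0 : (q%:R : K) != 0 by rewrite -(dvdn_pcharf chK) dvdn_prime2.
(* A root of [1 + X + ... + X ^ (q - 1)] is a [q]-th root of unity, and it differs from 1 because
   the value at 1 is [q], which is nonzero in characteristic [p]. *)
have [z /rootP z0] : exists z : K, root (\sum_(i < q) 'X^i) z.
  apply/closed_rootP; rewrite -(big_mkord xpredT (fun i => 'X^i)).
  have -> : \sum_(0 <= i < q) ('X^i : {poly K}) = \poly_(i < q) 1.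
    by rewrite poly_def big_mkord; apply: eq_bigr => i _; rewrite scale1r.
  rewrite size_poly_eq ?oner_eq0 //.
  by apply: contraTneq q_pr => ->.
move: z0; rewrite horner_sum; under eq_bigr do rewrite hornerXn; move=> z0.
have zq : z ^+ q = 1.
  by apply/eqP; rewrite -subr_eq0 subrX1 z0 mulr0.
have z1 : z != 1.
  apply: contraNneq q0 => z1; move: z0; rewrite z1.
  by under eq_bigr do rewrite expr1n; rewrite sumr_const card_ord => ->.
have p0 : (p%:R : 'F_q) != 0.
  by rewrite -(dvdn_pcharf (pchar_Fp q_pr)) dvdn_prime2 // eq_sym.
have Gp := legendre_gauss_sum_expp K q z q_pr q_odd zq p chK p_odd p0.
have G2 := legendre_gauss_sum_sqr K q z q_pr q_odd zq z1.
set G := \sum_x _ in Gp G2.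
have G0 : G != 0.
  rewrite -sqrf_eq0 G2 rmorphM /= mulf_neq0 //.
  by rewrite kronecker_primeN1 // rmorphXn /= rmorphN1 signr_eq0.
apply: (@Fp_inj_sign p) => //; try exact: kronecker_prime_le1.
rewrite kronecker_prime_Fp //; apply: (fmorph_inj f).
rewrite rmorphXn /= !rmorph_int -G2 -exprM; apply: (mulIf G0).
rewrite -Gp -exprSr; congr (_ ^+ _).
by have := odd_double_half p; rewrite p_odd mul2n add1n.
Qed.

(** Adding the case [p = q], where both sides vanish, lets [kronecker_reciprocity] treat a [C]
    divisible by [p] like any other. *)
Lemma kronecker_prime_reciprocity (p q : nat) :
  prime p -> odd p -> prime q -> odd q ->
  kronecker_prime p%:Z q = kronecker_prime (kronecker_prime (-1) q * q%:Z) p.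
Proof.
move=> p_pr p_odd q_pr q_odd.
have [<-|pq] := eqVneq p q; last exact: kronecker_prime_reciprocity_distinct.
rewrite kronecker_primeM //.
have /eqP -> : kronecker_prime p%:Z p == 0 by rewrite kronecker_prime_eq0.
by rewrite mulr0.
Qed.

(** * Kronecker symbols with prime power arguments *)

Lemma PoszX (n i : nat) : (n ^ i)%N%:Z = n%:Z ^+ i.
Proof. by elim: i => // i IH; rewrite expnS PoszM IH exprS. Qed.

Lemma modz4_prod1 (I : Type) (s : seq I) (F : I -> int) (P : pred I) :
  (forall i, P i -> (F i = 1 %[mod 4])%Z) -> (\prod_(i <- s | P i) F i = 1 %[mod 4])%Z.
Proof.
move=> HF; elim/big_rec: _ => // i x /HF Hi Hx.
by rewrite -modzMml Hi modzMml mul1r.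
Qed.

Lemma kronecker_primeX_left (p q i : nat) : prime q -> odd q ->
  kronecker_prime (p ^ i)%N%:Z q = kronecker_prime p%:Z q ^+ i.
Proof. by move=> q_pr q_odd; rewrite PoszX kronecker_primeX. Qed.

(* [(-1) ^+ q./2 * q] is the integer of absolute value [q] that is 1 modulo 4;
   for odd primes these multiply up to [- C]. *)
Lemma prod_signed_primes (C : int) : (C = -1 %[mod 4])%Z ->
  \prod_(q <- primes `|C|) ((-1) ^+ q./2 * q%:Z) ^+ logn q `|C| = - C :> int.
Proof.
move=> C4; set P := \prod_(_ <- _) _.
have n_odd : odd `|C| by lia.
have n0 : (0 < `|C|)%N by lia.
have P4 : (P = 1 %[mod 4])%Z.
  rewrite /P big_seq; apply: modz4_prod1 => q; rewrite mem_primes => /and3P[q_pr _ qC].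
  have q_odd : odd q := dvdn_odd qC n_odd.
  have H : ((-1) ^+ q./2 * q%:Z = 1 %[mod 4])%Z.
    by rewrite -signr_odd; case Eh: (odd q./2); rewrite ?expr0 ?expr1; lia.
  by rewrite -modzXm H modzXm expr1n.
(* [P] and [- C] are both 1 modulo 4, so equality of absolute values forces [P = - C]. *)
have absP : `|P| = `|C|%N%:Z.
  rewrite /P normr_prod [in RHS](prod_prime_decomp n0) prime_decompE big_map /=.
  rewrite (big_morph Posz PoszM (erefl 1%:Z)); apply: eq_bigr => q _.
  by rewrite normrX normrMsign PoszX.
lia.
Qed.

(** Reciprocity is multiplied over the prime factors of [C], whose signed versions have product
    [- C]. The sign of [C] contributes nothing because the numerator is nonnegative. *)
Lemma kronecker_reciprocity (p i : nat) (C : int) :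
  prime p -> odd p -> (C = -1 %[mod 4])%Z ->
  kronecker (p ^ i)%N%:Z C = kronecker_prime (- C) p ^+ i.
Proof.
move=> p_pr p_odd C4; rewrite /kronecker.
have -> : (C == 0) = false by lia.
rewrite andbF mul1r -(prod_signed_primes C C4).
rewrite (big_morph (fun a => kronecker_prime a p) (id1 := 1) (op1 := *%R)); first last.
- exact: kronecker_prime1.
- by move=> a b; exact: kronecker_primeM.
rewrite -prodrXl !big_seq; apply: eq_bigr => q; rewrite mem_primes => /and3P[q_pr _ qC].
have q_odd : odd q by apply: dvdn_odd qC _; lia.
rewrite kronecker_primeX_left // kronecker_primeX // -kronecker_primeN1 //.
by rewrite -kronecker_prime_reciprocity // exprAC.
Qed.

Lemma kronecker_pfactor (p m : nat) (a : int) : prime p ->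
  kronecker a (p ^ m)%N%:Z = kronecker_prime a p ^+ m.
Proof.
move=> p_pr; rewrite /kronecker.
have pm0 : (0 < p ^ m)%N by rewrite expn_gt0 prime_gt0.
have -> : ((p ^ m)%N%:Z == 0) = false by lia.
rewrite mul1r absz_nat; case: m pm0 => [|m] _; first by rewrite big_nil.
by rewrite primesX // primes_prime // big_seq1 pfactorK.
Qed.

Lemma kronecker_pfactorN (p m : nat) (a : int) : prime p ->
  kronecker a (- (p ^ m)%N%:Z) =
  (if a < 0 then -1 else 1) * kronecker_prime a p ^+ m.
Proof.
move=> p_pr; rewrite -kronecker_pfactor // /kronecker.
have pm0 : (0 < p ^ m)%N by rewrite expn_gt0 prime_gt0.
have -> : (- (p ^ m)%N%:Z == 0) = false by lia.
have -> : ((p ^ m)%N%:Z == 0) = false by lia.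
by rewrite mul1r abszN oppr_lt0 ltz_nat pm0.
Qed.

Lemma kronecker1l (n : int) : kronecker 1 n = 1.
Proof.
rewrite /kronecker; case: eqP => // _; rewrite andbF mul1r big_seq big1 // => q.
by rewrite mem_primes => /and3P[q_pr _ _]; rewrite kronecker_prime1 // expr1n.
Qed.

Lemma kronecker_N1_cases (n : int) : n != 0 ->
  kronecker (-1) n = 1 \/ kronecker (-1) n = -1.
Proof.
move=> n0; suff: `|kronecker (-1) n| = 1 by lia.
rewrite /kronecker (negbTE n0) normrM.
rewrite [X in X * _](_ : _ = 1); last by case: ifP.
rewrite mul1r normr_prod big_seq big1 // => q; rewrite mem_primes => /and3P[q_pr _ _].
rewrite normrX; case: (kronecker_prime_cases q (-1)) => E; rewrite E ?normrN ?normr1 ?expr1n //.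
move/eqP: E; rewrite kronecker_prime_eq0 dvdzE abszN1 absz_nat dvdn1 => /eqP q1.
by move: q_pr; rewrite q1.
Qed.

(** The lower argument is 1 modulo 4. This disposes of the factor of the splitting that involves
    [eps]. *)
Lemma kronecker_N1_mod4 (p m : nat) (mu : int) :
  prime p -> odd p -> mu = 1 \/ mu = -1 -> ((p ^ m)%N%:Z = - mu %[mod 4])%Z ->
  kronecker (-1) (- (mu * (p ^ m)%N%:Z)) = 1.
Proof.
move=> p_pr p_odd mu1.
have Hp : ((p ^ m)%N%:Z = (-1) ^+ (p./2 * m)%N %[mod 4])%Z.
  rewrite PoszX exprM -modzXm -[RHS]modzXm; congr (_ ^+ _ %% _)%Z.
  by rewrite -signr_odd; case Eh: (odd p./2); rewrite ?expr0 ?expr1; lia.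
rewrite Hp; have E := kronecker_primeN1 p p_pr p_odd.
case: mu1 => ->; rewrite ?mul1r ?mulN1r ?opprK ?kronecker_pfactorN ?kronecker_pfactor //=.
  by rewrite E -exprM -signr_odd; case: (odd _).
by rewrite E -exprM -signr_odd; case: (odd _).
Qed.

(** * The additive character and sums over residue classes *)

Lemma expi2piD (R : realType) (x y : R) :
  expi2pi (x + y) = expi2pi x * expi2pi y.
Proof.
rewrite /expi2pi mulrDr cosD sinD; apply/eqP.
by rewrite eq_complex /= eqxx addrC eqxx.
Qed.

Lemma expi2pi0 (R : realType) : expi2pi (0 : R) = 1.
Proof. by rewrite /expi2pi mulr0 cos0 sin0. Qed.

Lemma expi2pi1 (R : realType) : expi2pi (1 : R) = 1.
Proof. by rewrite /expi2pi mulr1 mulr_natl cos2pi sin2pi. Qed.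

Lemma expi2pi_int (R : realType) (n : int) : expi2pi (n%:~R : R) = 1.
Proof.
have pos (m : nat) : expi2pi (m%:R : R) = 1.
  by elim: m => [|m IH]; rewrite ?expi2pi0 // -natr1 expi2piD IH expi2pi1 mulr1.
case: n => m; first exact: pos.
by have := expi2piD R (- m.+1%:R) m.+1%:R; rewrite pos mulr1 addNr expi2pi0 NegzE mulrNz.
Qed.

Lemma expi2pi_shift (R : realType) (x y : R) (n : int) :
  x - y = n%:~R -> expi2pi x = expi2pi y.
Proof. by move=> H; rewrite -[x](subrK y) H expi2piD expi2pi_int mul1r. Qed.

Lemma sum_periodic (V : nmodType) (n m : nat) (f : int -> V) :
  (forall x y : int, (n%:Z %| x - y)%Z -> f x = f y) ->
  \sum_(x < n * m) f x%:Z = (\sum_(x < n) f x%:Z) *+ m.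
Proof.
move=> fP; elim: m => [|m IH]; first by rewrite muln0 big_ord0 mulr0n.
rewrite mulnS big_split_ord /= mulrS -IH; congr (_ + _); apply: eq_bigr => x _.
by apply: fP; rewrite PoszD addrK dvdzz.
Qed.

Lemma sum_affine (V : nmodType) (n : nat) (a b : int) (f : int -> V) :
  (0 < n)%N -> coprimez a n%:Z ->
  (forall x y : int, (n%:Z %| x - y)%Z -> f x = f y) ->
  \sum_(x < n) f (a * x%:Z + b) = \sum_(x < n) f x%:Z.
Proof.
move=> n0 an fP.
have lt_mod (z : int) : (`|(z %% n%:Z)%Z| < n)%N by lia.
pose h (x : 'I_n) := Ordinal (lt_mod (a * x%:Z + b)).
have h_inj : injective h.
  move=> x y /(congr1 val) /= E; apply: val_inj => /=.
  have : (n%:Z %| a * (x%:Z - y%:Z))%Z.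
    have -> : a * (x%:Z - y%:Z) = (a * x + b) - (a * y + b) by ring.
    by rewrite -eqz_mod_dvd; apply/eqP; lia.
  rewrite Gauss_dvdzr; last by rewrite coprimez_sym.
  rewrite -eqz_mod_dvd => /eqP; rewrite !modz_nat => -[].
  by rewrite !modn_small.
rewrite [RHS](reindex_inj h_inj); apply: eq_bigr => x _; apply: fP.
by rewrite -eqz_mod_dvd /=; apply/eqP; rewrite gez0_abs ?modz_mod //; lia.
Qed.

(** * Matrices of size 3, the groups [Gamma] and [Gamma_inf], double cosets *)

Lemma ord3_cases (i : 'I_3) : [\/ i = 0, i = 1 | i = 2].
Proof.
by case: i => [[|[|[|n]]] // ni];
  [constructor 1|constructor 2|constructor 3]; apply: val_inj.
Qed.

Lemma big_ord3 (V : nmodType) (F : 'I_3 -> V) :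
  \sum_i F i = F 0 + F 1 + F 2.
Proof.
rewrite !big_ord_recl big_ord0 addr0 addrA.
by congr (F _ + F _ + F _); apply: val_inj.
Qed.

Lemma mulmx3E (A B : 'M[int]_3) i j :
  (A *m B) i j = A i 0 * B 0 j + A i 1 * B 1 j + A i 2 * B 2 j.
Proof. by rewrite mxE big_ord3. Qed.

Lemma det_mx3 (M : 'M[int]_3) : \det M =
  M 0 0 * (M 1 1 * M 2 2 - M 1 2 * M 2 1)
  - M 0 1 * (M 1 0 * M 2 2 - M 1 2 * M 2 0)
  + M 0 2 * (M 1 0 * M 2 1 - M 1 1 * M 2 0).
Proof.
have det2 (N : 'M[int]_2) : \det N = N 0 0 * N 1 1 - N 0 1 * N 1 0.
  rewrite (expand_det_row _ 0) !big_ord_recl big_ord0 addr0 /cofactor !det_mx11 !mxE.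
  have -> : lift 0 0 = 1 :> 'I_2 by apply: val_inj.
  have -> : lift 1 0 = 0 :> 'I_2 by apply: val_inj.
  by rewrite /= expr0 expr1 mul1r mulN1r mulrN.
rewrite (expand_det_row _ 0) big_ord3 /cofactor !det2 !mxE /=.
have -> : lift 0 0 = 1 :> 'I_3 by apply: val_inj.
have -> : lift 0 1 = 2 :> 'I_3 by apply: val_inj.
have -> : lift 1 0 = 0 :> 'I_3 by apply: val_inj.
have -> : lift 1 1 = 2 :> 'I_3 by apply: val_inj.
have -> : lift 2 0 = 0 :> 'I_3 by apply: val_inj.
have -> : lift 2 1 = 1 :> 'I_3 by apply: val_inj.
by rewrite expr0 expr1 expr2; ring.
Qed.

Definition mx3 (a b c d e f g h i : int) : 'M[int]_3 :=
  \matrix_(r, s) nth 0 [:: a; b; c; d; e; f; g; h; i] (3 * r + s)%N.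

Lemma mx3E (a b c d e f g h i : int) (M := mx3 a b c d e f g h i) :
  (M 0 0 = a) * (M 0 1 = b) * (M 0 2 = c) * (M 1 0 = d) * (M 1 1 = e) *
  (M 1 2 = f) * (M 2 0 = g) * (M 2 1 = h) * (M 2 2 = i).
Proof. by rewrite /M /mx3 !mxE. Qed.

Lemma Gamma_infP (u : 'M[int]_3) : Gamma_inf u <->
  [/\ u 0 0 = 1, u 1 1 = 1 & u 2 2 = 1] /\ [/\ u 1 0 = 0, u 2 0 = 0 & u 2 1 = 0].
Proof.
split=> [H|[[H00 H11 H22] [H10 H20 H21]] i j].
  by split; split; rewrite H.
by case: (ord3_cases i) => ->; case: (ord3_cases j) => ->.
Qed.

Lemma GammaP (M : 'M[int]_3) : Gamma M <->
  \det M = 1 /\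
  ([/\ ((M 0 0)%R = 1 %[mod 4])%Z, ((M 1 1)%R = 1 %[mod 4])%Z & ((M 2 2)%R = 1 %[mod 4])%Z] /\
   [/\ ((M 1 0)%R = 0 %[mod 4])%Z, ((M 2 0)%R = 0 %[mod 4])%Z & ((M 2 1)%R = 0 %[mod 4])%Z]).
Proof.
split=> [[dM H]|[dM [[H00 H11 H22] [H10 H20 H21]]]].
  by split=> //; split; split; rewrite H.
split=> // i j.
by case: (ord3_cases i) => ->; case: (ord3_cases j) => ->.
Qed.

Lemma det_Gamma_inf (u : 'M[int]_3) : Gamma_inf u -> \det u = 1.
Proof. by case/Gamma_infP=> [[H00 H11 H22] [H10 H20 H21]]; rewrite det_mx3 H00 H11 H22 H10 H20 H21; ring. Qed.

Lemma Gamma_mull (u M : 'M[int]_3) : Gamma_inf u -> Gamma M -> Gamma (u *m M).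
Proof.
move=> gu; have du := det_Gamma_inf u gu; case/Gamma_infP: gu => [[H00 H11 H22] [H10 H20 H21]].
case/GammaP=> dM [[M00 M11 M22] [M10 M20 M21]]; apply/GammaP.
rewrite det_mulmx du dM mulr1 !mulmx3E H00 H11 H22 H10 H20 H21.
by split=> //; split; split; lia.
Qed.

Lemma Gamma_mulr (M v : 'M[int]_3) : Gamma_inf v -> Gamma M -> Gamma (M *m v).
Proof.
move=> gu; have du := det_Gamma_inf v gu; case/Gamma_infP: gu => [[H00 H11 H22] [H10 H20 H21]].
case/GammaP=> dM [[M00 M11 M22] [M10 M20 M21]]; apply/GammaP.
rewrite det_mulmx du dM mulr1 !mulmx3E H00 H11 H22 H10 H20 H21.
by split=> //; split; split; lia.
Qed.

Lemma Gamma_inf1 : Gamma_inf (1%:M : 'M[int]_3).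
Proof. by apply/Gamma_infP; rewrite !mxE. Qed.

Lemma Gamma_infM (u v : 'M[int]_3) : Gamma_inf u -> Gamma_inf v -> Gamma_inf (u *m v).
Proof.
case/Gamma_infP=> [[U00 U11 U22] [U10 U20 U21]].
case/Gamma_infP=> [[V00 V11 V22] [V10 V20 V21]].
apply/Gamma_infP; rewrite !mulmx3E U00 U11 U22 U10 U20 U21 V00 V11 V22 V10 V20 V21.
by split; split; ring.
Qed.

(** The entries are explicit so that the first column shows the minors of the lower two rows, that
    is, the second triple of Pluecker coordinates. *)
Definition adj3 (M : 'M[int]_3) : 'M[int]_3 := mx3
  (M 1 1 * M 2 2 - M 1 2 * M 2 1) (M 0 2 * M 2 1 - M 0 1 * M 2 2) (M 0 1 * M 1 2 - M 0 2 * M 1 1)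
  (M 1 2 * M 2 0 - M 1 0 * M 2 2) (M 0 0 * M 2 2 - M 0 2 * M 2 0) (M 0 2 * M 1 0 - M 0 0 * M 1 2)
  (M 1 0 * M 2 1 - M 1 1 * M 2 0) (M 0 1 * M 2 0 - M 0 0 * M 2 1) (M 0 0 * M 1 1 - M 0 1 * M 1 0).

Lemma mul_adj3 (M : 'M[int]_3) : \det M = 1 -> adj3 M *m M = 1%:M.
Proof.
rewrite det_mx3 => dM; apply/matrixP => i j.
by case: (ord3_cases i) => ->; case: (ord3_cases j) => ->;
  rewrite mulmx3E !mx3E mxE /= ?mulr1n ?mulr0n -?dM; ring.
Qed.

Lemma Gamma_infV (u : 'M[int]_3) : Gamma_inf u ->
  exists v, [/\ Gamma_inf v, v *m u = 1%:M & u *m v = 1%:M].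
Proof.
move=> gu; have H := mul_adj3 u (det_Gamma_inf u gu); exists (adj3 u); split=> //; last exact: mulmx1C.
case/Gamma_infP: gu => [[H00 H11 H22] [H10 H20 H21]].
by apply/Gamma_infP; rewrite !mx3E H00 H11 H22 H10 H20 H21; split; split; ring.
Qed.

Lemma dcoset_refl (M : 'M[int]_3) : dcoset M M.
Proof. by exists 1%:M, 1%:M; rewrite mul1mx mulmx1; split=> //; exact: Gamma_inf1. Qed.

Lemma dcoset_eq (M N : 'M[int]_3) : dcoset M N -> dcoset N = dcoset M.
Proof.
case=> u [v [gu gv ->]].
have [u' [gu' u'u _]] := Gamma_infV u gu.
have [v' [gv' _ vv']] := Gamma_infV v gv.
apply/seteqP; split=> X [a [b [ga gb ->]]].
  exists (a *m u), (v *m b); rewrite !mulmxA; split=> //; exact: Gamma_infM.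
exists (a *m u'), (v' *m b); split; try exact: Gamma_infM.
rewrite !mulmxA -(mulmxA a u') u'u mulmx1 -(mulmxA _ v) vv' mulmx1 //.
Qed.

(** * Pluecker coordinates as parameters for [Gamma] modulo [Gamma_inf] *)

Lemma Gamma_pl (M : 'M[int]_3) : Gamma M ->
  [/\ M 2 0 = - (4 * plA1 M), M 2 1 = - (4 * plB1 M) & M 2 2 = - plC1 M] /\
  [/\ M 1 0 * M 2 1 - M 1 1 * M 2 0 = - (4 * plA2 M),
      M 1 0 * M 2 2 - M 1 2 * M 2 0 = 4 * plB2 M &
      M 1 1 * M 2 2 - M 1 2 * M 2 1 = - plC2 M].
Proof.
case/GammaP=> dM [[M00 M11 M22] [M10 M20 M21]].
have H1 : (4 %| (M 1 0 * M 2 1 - M 1 1 * M 2 0)%R)%Z by lia.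
have H2 : (4 %| (M 1 0 * M 2 2 - M 1 2 * M 2 0)%R)%Z by lia.
rewrite /plA1 /plB1 /plC1 /plA2 /plB2 /plC2 !opprK; split; split=> //; lia.
Qed.

Lemma Gamma_pl_mod4 (M : 'M[int]_3) : Gamma M ->
  (plC1 M = -1 %[mod 4])%Z /\ (plC2 M = -1 %[mod 4])%Z.
Proof.
case/GammaP=> dM [[M00 M11 M22] [M10 M20 M21]].
by rewrite /plC1 /plC2; split; first lia; nia.
Qed.

(** The third row is orthogonal to its cross product with the second row. *)
Lemma Gamma_pl_rel (M : 'M[int]_3) : Gamma M ->
  plA1 M * plC2 M + 4 * plB1 M * plB2 M + plC1 M * plA2 M = 0.
Proof.
case/Gamma_pl => -[H20 H21 H22] [HA HB HC].
suff : (- (4 * plA1 M)) * (- plC2 M) - (- (4 * plB1 M)) * (4 * plB2 M)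
   + (- plC1 M) * (- (4 * plA2 M)) = 0 by lia.
by rewrite -H20 -H21 -H22 -HA -HB -HC; ring.
Qed.

(** Expand the determinant, which is 1, along the third row. *)
Lemma Gamma_pl_prim1 (M : 'M[int]_3) (d : int) : Gamma M ->
  (d %| plA1 M)%Z -> (d %| plB1 M)%Z -> (d %| plC1 M)%Z -> (d %| 1)%Z.
Proof.
move=> gM dA dB dC; have [[H20 H21 H22] _] := Gamma_pl M gM.
have -> : 1%Z = \det M by case: gM => ->.
rewrite det_mx3.
have -> : forall a b c d e f g h i : int,
   a * (e * i - f * h) - b * (d * i - f * g) + c * (d * h - e * g)
   = g * (b * f - c * e) + h * (c * d - a * f) + i * (a * e - b * d).
  by move=> *; ring.
rewrite H20 H21 H22; by apply: rpredD; [apply: rpredD|]; apply: dvdz_mulr; rewrite rpredN ?dvdz_mull.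
Qed.

(** Expand the determinant along the first row. *)
Lemma Gamma_pl_prim2 (M : 'M[int]_3) (d : int) : Gamma M ->
  (d %| plA2 M)%Z -> (d %| plB2 M)%Z -> (d %| plC2 M)%Z -> (d %| 1)%Z.
Proof.
move=> gM dA dB dC; have [_ [HA HB HC]] := Gamma_pl M gM.
have -> : 1%Z = \det M by case: gM => ->.
rewrite det_mx3 HA HB HC.
by apply: rpredD; [apply: rpredB|]; apply: dvdz_mull; rewrite 1?rpredN ?dvdz_mull.
Qed.

Lemma pl_mull (u M : 'M[int]_3) : Gamma_inf u ->
  [/\ plA1 (u *m M) = plA1 M, plB1 (u *m M) = plB1 M & plC1 (u *m M) = plC1 M] /\
  [/\ plA2 (u *m M) = plA2 M, plB2 (u *m M) = plB2 M & plC2 (u *m M) = plC2 M].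
Proof.
case/Gamma_infP=> [[H00 H11 H22] [H10 H20 H21]].
rewrite /plA1 /plB1 /plC1 /plA2 /plB2 /plC2 !mulmx3E H11 H22 H10 H20 H21.
by split; split; do ?congr (_ %/ _)%Z; ring.
Qed.

Lemma pl_mulr (M v : 'M[int]_3) : Gamma_inf v -> Gamma M ->
  [/\ plA1 (M *m v) = plA1 M, plB1 (M *m v) = plB1 M + v 0 1 * plA1 M &
      plC1 (M *m v) = plC1 M + 4 * v 1 2 * plB1 M + 4 * v 0 2 * plA1 M] /\
  [/\ plA2 (M *m v) = plA2 M, plB2 (M *m v) = plB2 M - v 1 2 * plA2 M &
      plC2 (M *m v) = plC2 M - 4 * v 0 1 * plB2 M
                      + 4 * (v 0 1 * v 1 2 - v 0 2) * plA2 M].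
Proof.
move=> gv gM; have [[M20 M21 M22] [HA HB HC]] := Gamma_pl M gM.
have [[N20 N21 N22] [KA KB KC]] := Gamma_pl _ (Gamma_mulr M v gv gM).
case/Gamma_infP: gv => [[H00 H11 H22] [H10 H20 H21]].
move: N20 N21 N22 KA KB KC; rewrite !mulmx3E H00 H11 H22 H10 H20 H21.
set A1 := plA1 (M *m v); set B1 := plB1 (M *m v); set C1 := plC1 (M *m v).
set A2 := plA2 (M *m v); set B2 := plB2 (M *m v); set C2 := plC2 (M *m v).
move=> N20 N21 N22 KA KB KC.
split; split.
- lia.
- suff : - (4 * B1) = - (4 * (plB1 M + v 0 1 * plA1 M)) by lia.
  by rewrite -N21 M20 M21; ring.
- suff : - C1 = - (plC1 M + 4 * v 1 2 * plB1 M + 4 * v 0 2 * plA1 M) by lia.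
  by rewrite -N22 M20 M21 M22; ring.
- suff : - (4 * A2) = - (4 * plA2 M) by lia.
  by rewrite -KA -HA; ring.
- suff : 4 * B2 = 4 * plB2 M + v 1 2 * (- (4 * plA2 M)) by lia.
  by rewrite -KB -HA -HB; ring.
- suff : - C2 = - plC2 M + v 0 1 * (4 * plB2 M)
                      + (v 0 1 * v 1 2 - v 0 2) * (- (4 * plA2 M)) by lia.
  by rewrite -KC -HA -HB -HC; ring.
Qed.

(** The witness is [N] times the inverse of [M]. Its first column pairs the rows of [N] with the
    minors of [N], its third row pairs the third row of [M] with the columns of the inverse of [M];
    only the middle entry needs a rearrangement. *)
Lemma pl_inj (M N : 'M[int]_3) : Gamma M -> Gamma N ->
  [/\ plA1 M = plA1 N, plB1 M = plB1 N & plC1 M = plC1 N] ->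
  [/\ plA2 M = plA2 N, plB2 M = plB2 N & plC2 M = plC2 N] ->
  exists2 u, Gamma_inf u & N = u *m M.
Proof.
move=> gM gN [eA1 eB1 eC1] [eA2 eB2 eC2].
have [[M20 M21 M22] [MA MB MC]] := Gamma_pl M gM.
have [[N20 N21 N22] [NA NB NC]] := Gamma_pl N gN.
have [dM _] := gM; have [dN _] := gN.
exists (N *m adj3 M); last by rewrite -mulmxA mul_adj3 // mulmx1.
rewrite det_mx3 in dN; rewrite det_mx3 in dM.
have E20 : M 2 0 = N 2 0 by rewrite M20 N20 eA1.
have E21 : M 2 1 = N 2 1 by rewrite M21 N21 eB1.
have E22 : M 2 2 = N 2 2 by rewrite M22 N22 eC1.
have EA : M 1 0 * M 2 1 - M 1 1 * M 2 0 = N 1 0 * N 2 1 - N 1 1 * N 2 0.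
  by rewrite MA NA eA2.
have EB : M 1 0 * M 2 2 - M 1 2 * M 2 0 = N 1 0 * N 2 2 - N 1 2 * N 2 0.
  by rewrite MB NB eB2.
have EC : M 1 1 * M 2 2 - M 1 2 * M 2 1 = N 1 1 * N 2 2 - N 1 2 * N 2 1.
  by rewrite MC NC eC2.
have EB' : M 1 2 * M 2 0 - M 1 0 * M 2 2 = - (N 1 0 * N 2 2 - N 1 2 * N 2 0).
  by rewrite -EB; ring.
apply/Gamma_infP; rewrite !mulmx3E !mx3E EA EB' EC; split; split.
- by rewrite -dN; ring.
(* The middle entry is regrouped as the first row of [M] paired with the common minors, which is
   [\det M]. *)
- rewrite E20 E21 E22 -[RHS]dM EA EB EC.
  have -> : N 1 0 * (M 0 2 * N 2 1 - M 0 1 * N 2 2) + N 1 1 * (M 0 0 * N 2 2 - M 0 2 * N 2 0)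
    + N 1 2 * (M 0 1 * N 2 0 - M 0 0 * N 2 1) =
    M 0 0 * (N 1 1 * N 2 2 - N 1 2 * N 2 1) - M 0 1 * (N 1 0 * N 2 2 - N 1 2 * N 2 0)
    + M 0 2 * (N 1 0 * N 2 1 - N 1 1 * N 2 0) by ring.
  by [].
- by rewrite -E20 -E21 -E22 -[RHS]dM; ring.
- ring.
- ring.
- by rewrite -E20 -E21 -E22; ring.
Qed.

Lemma pl_surj (a1 b1 c1 a2 b2 c2 x1 y1 z1 x2 y2 z2 : int) :
  a1 * c2 + 4 * b1 * b2 + c1 * a2 = 0 ->
  (c1 = -1 %[mod 4])%Z -> (c2 = -1 %[mod 4])%Z ->
  4 * a1 * x1 + 4 * b1 * y1 + c1 * z1 = 1 ->
  4 * a2 * x2 + 4 * b2 * y2 + c2 * z2 = 1 ->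
  exists M, [/\ Gamma M, [/\ plA1 M = a1, plB1 M = b1 & plC1 M = c1] &
                [/\ plA2 M = a2, plB2 M = b2 & plC2 M = c2]].
Proof.
move=> rel c14 c24 bz1 bz2.
(* With [v] the third row, [w] the row of minors, [v . v' = 1] and
   [v . w = 0], the row [v' x w] satisfies [(v' x w) x v = w]. *)
pose d := 4 * (y1 * a2 - z1 * b2); pose e := z1 * c2 - 4 * x1 * a2.
pose f := 4 * x1 * b2 - y1 * c2.
(* With this first row, expansion along it is the second Bezout relation, so the determinant is
   1. *)
pose M := mx3 (- z2) (- y2) (- x2) d e f (- (4 * a1)) (- (4 * b1)) (- c1).
have HA : d * - (4 * b1) - e * - (4 * a1) = - (4 * a2).
  have -> : d * - (4 * b1) - e * - (4 * a1) =
     4 * z1 * (a1 * c2 + 4 * b1 * b2 + c1 * a2)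
     - 4 * a2 * (4 * a1 * x1 + 4 * b1 * y1 + c1 * z1) by rewrite /d /e; ring.
  by rewrite rel bz1; ring.
have HB : d * - c1 - f * - (4 * a1) = 4 * b2.
  have -> : d * - c1 - f * - (4 * a1) =
     - 4 * y1 * (a1 * c2 + 4 * b1 * b2 + c1 * a2)
     + 4 * b2 * (4 * a1 * x1 + 4 * b1 * y1 + c1 * z1) by rewrite /d /f; ring.
  by rewrite rel bz1; ring.
have HC : e * - c1 - f * - (4 * b1) = - c2.
  have -> : e * - c1 - f * - (4 * b1) =
     4 * x1 * (a1 * c2 + 4 * b1 * b2 + c1 * a2)
     - c2 * (4 * a1 * x1 + 4 * b1 * y1 + c1 * z1) by rewrite /e /f; ring.
  by rewrite rel bz1; ring.
have gM : Gamma M.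
  apply/GammaP; rewrite det_mx3 !mx3E HA HB HC; split; last first.
    (* Modulo 4 the Bezout relations read [z1 = z2 = -1], whence the diagonal entries [- z2] and [e]
       are 1. *)
    have [t1 Et1] : exists t, c1 = 4 * t - 1 by exists ((c1 + 1) %/ 4)%Z; lia.
    have [t2 Et2] : exists t, c2 = 4 * t - 1 by exists ((c2 + 1) %/ 4)%Z; lia.
    move: bz1 bz2; rewrite /d /e Et1 Et2 => bz1' bz2'.
    by split; split; lia.
  by rewrite -[RHS]bz2; ring.
exists M; split=> //; rewrite /plA1 /plB1 /plC1 /plA2 /plB2 /plC2 !mx3E ?HA ?HB ?HC; split; lia.
Qed.

(** * Auxiliary arithmetic: congruences modulo 4, Bezout relations, powers of a prime *)

Lemma kronecker_prime_sqr (q : nat) (a : int) :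
  ~~ (q%:Z %| a)%Z -> kronecker_prime a q ^+ 2 = 1.
Proof.
rewrite -kronecker_prime_eq0.
by case: (kronecker_prime_cases q a) => ->; rewrite ?eqxx.
Qed.

Lemma kronecker1r (a : int) : kronecker a 1 = 1.
Proof. by rewrite /kronecker /= big_nil. Qed.

Lemma eq_mod4P (a b : int) : (a = b %[mod 4])%Z <-> exists t, a = 4 * t + b.
Proof.
split=> [E|[t ->]]; first by exists ((a - b) %/ 4)%Z; lia.
by rewrite mulrC modzMDl.
Qed.

Lemma odd_sqr_mod4 (n : nat) : odd n -> (n%:Z ^+ 2 = 1 %[mod 4])%Z.
Proof.
move=> n_odd; rewrite -(odd_double_half n) n_odd /=; apply/eq_mod4P.
exists (n./2%:Z * (n./2%:Z + 1)).
by rewrite PoszD -mul2n PoszM; ring.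
Qed.

Lemma odd_Bezout (a C : int) : (C = -1 %[mod 4])%Z -> coprimez C a ->
  exists u v : int, 4 * a * u + C * v = 1.
Proof.
move=> C4 Ca; have : coprimez (4 * a) C.
  rewrite coprimezMl (coprimez_sym a) Ca andbT.
  by rewrite (_ : 4 = 2%:Z ^+ 2) // coprimezXl // coprimezE coprime2n; lia.
by case/coprimezP => -[u v] /= E; exists u, v; rewrite -[RHS]E; ring.
Qed.

(** The exponent is the valuation capped at [l]. For [i = l] the cofactor may still be divisible by
    [P], and [b = 0] is covered. *)
Lemma extract_power (P b : int) (l : nat) :
  exists i x, [/\ (i <= l)%N, b = P ^+ i * x & (i < l)%N -> ~~ (P %| x)%Z].
Proof.
elim: l b => [|l IH] b; first by exists 0%N, b; rewrite expr0 mul1r.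
have [/dvdzP[q ->]|Pb] := boolP (P %| b)%Z; last by exists 0%N, b; rewrite expr0 mul1r.
have [i [x [il -> Px]]] := IH q.
by exists i.+1, x; split=> //; rewrite exprSr mulrAC.
Qed.

(** * Double cosets for [A_1 = p ^ k] and [A_2 = mu * p ^ l] *)

Section PrimePowerCosets.
Variables (p : nat) (mu : int) (k l : nat).
Hypotheses (p_pr : prime p) (p_odd : odd p) (mu1 : mu = 1 \/ mu = -1).
Hypotheses (lk : (l < k)%N).
Hypothesis p_mu : (p%:Z ^+ (k - l) = - mu %[mod 4])%Z.

Local Notation P := (p%:Z).

Let P0 : P != 0. Proof. by rewrite eqz_nat -lt0n prime_gt0. Qed.
Let Pn0 n : P ^+ n != 0. Proof. exact: expf_neq0. Qed.
Let P1 : ~~ (P %| 1)%Z.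
Proof. by rewrite dvdz1 absz_nat gtn_eqF // prime_gt1. Qed.
Let P_exp n : (0 < n)%N -> (P %| P ^+ n)%Z.
Proof. by move=> n0; rewrite dvdz_exp. Qed.
Let P_Euclid (a b : int) : (P %| a * b)%Z = (P %| a)%Z || (P %| b)%Z.
Proof. by rewrite !dvdzE abszM Euclid_dvdM. Qed.
Let P_coprime (a : int) n : ~~ (P %| a)%Z -> coprimez (P ^+ n) a.
Proof. by move=> Pa; apply: coprimezXl; rewrite coprimezE prime_coprime. Qed.
Let P_4 : ~~ (P %| 4)%Z.
Proof.
rewrite -[4%Z]/(2%:Z * 2%:Z) P_Euclid orbb dvdzE !absz_nat dvdn_prime2 //.
by apply: contraTneq p_odd => ->.
Qed.
Let mumu : mu * mu = 1. Proof. by case: mu1 => ->. Qed.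

(* In terms of these data, [D_1 = p ^ i] and [D_2 = p ^ (l - i)]. *)
Definition pl_data (i : nat) (x y c : int) (M : 'M[int]_3) : Prop :=
  [/\ Gamma M,
      [/\ plA1 M = P ^+ k, plB1 M = P ^+ i * x &
          plC1 M = - mu * (4 * (x * y) + P ^+ (k - l) * (4 * c - 1))] &
      [/\ plA2 M = mu * P ^+ l, plB2 M = P ^+ (l - i) * y & plC2 M = 4 * c - 1]].

(** The conditions on [x], [y], [c] express primitivity at [p] of the two coordinate triples. *)
Definition admissible (i : nat) (x y c : int) : bool :=
  [&& (i <= l)%N, ~~ (P %| x)%Z, (0 < i)%N ==> ~~ (P %| y)%Z &
      (i < l)%N ==> ~~ (P %| 4 * c - 1)%Z].

Lemma pl_dataI i x y c M : (i <= l)%N -> Gamma M ->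
  plA1 M = P ^+ k -> plB1 M = P ^+ i * x -> plA2 M = mu * P ^+ l ->
  plB2 M = P ^+ (l - i) * y -> plC2 M = 4 * c - 1 -> pl_data i x y c M.
Proof.
move=> il gM A1 B1 A2 B2 C2; have rel := Gamma_pl_rel M gM.
rewrite A1 B1 A2 B2 C2 in rel; split=> //; split=> //.
have El : P ^+ l = P ^+ i * P ^+ (l - i) by rewrite -exprD subnKC.
have Ek : P ^+ k = P ^+ l * P ^+ (k - l) by rewrite -exprD subnKC // ltnW.
apply: (mulIf (Pn0 l)); apply/eqP; rewrite -subr_eq0 -(mulr0 mu) -[X in mu * X]rel.
rewrite -[plC1 M in X in X == _]mul1r -mumu Ek El; apply/eqP; ring.
Qed.

(** As [k > l], [C_1] is a multiple of [x * y] modulo [P]. So a factor [P] of [x], or of [y] when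
    [i > 0], would divide the whole first triple; a factor [P] of [4 * c - 1] when [i < l] would
    divide the second. *)
Lemma pl_data_admissible i x y c M : (i <= l)%N -> pl_data i x y c M ->
  admissible i x y c.
Proof.
move=> il [gM [A1 B1 C1] [A2 B2 C2]].
have prim1 := Gamma_pl_prim1 M P gM; rewrite A1 B1 in prim1.
have prim2 := Gamma_pl_prim2 M P gM; rewrite A2 C2 B2 in prim2.
have kl0 : (0 < k - l)%N by rewrite subn_gt0.
have k0 : (0 < k)%N by apply: leq_ltn_trans lk.
have PC1 : (P %| x * y)%Z -> (P %| plC1 M)%Z.
  by move=> Hxy; rewrite C1 dvdz_mull // rpredD //; [rewrite dvdz_mull|rewrite dvdz_mulr ?P_exp].
apply/and4P; split=> //.
- apply/negP => Hx; apply: (negP P1); apply: prim1; first exact: P_exp.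
    by rewrite dvdz_mull.
  by apply: PC1; rewrite dvdz_mulr.
- apply/implyP => i0; apply/negP => Hy; apply: (negP P1); apply: prim1; first exact: P_exp.
    by rewrite dvdz_mulr // P_exp.
  by apply: PC1; rewrite dvdz_mull.
- apply/implyP => il'; apply/negP => Hc; apply: (negP P1); apply: prim2 => //.
    by rewrite dvdz_mull // P_exp // (leq_ltn_trans _ il').
  by rewrite dvdz_mulr // P_exp // subn_gt0.
Qed.

Lemma bigS_pl_data (M : 'M[int]_3) : bigS (P ^+ k) (mu * P ^+ l) M ->
  exists i x y c, (i <= l)%N /\ pl_data i x y c M.
Proof.
case=> gM [A1 A2]; have [_ C24] := Gamma_pl_mod4 M gM.
have [c C2] := (eq_mod4P _ _).1 C24.
have rel := Gamma_pl_rel M gM; rewrite A1 A2 C2 in rel.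
have [i [x [il B1 Px]]] := extract_power P (plB1 M) l.
rewrite B1 in rel.
have El : P ^+ l = P ^+ i * P ^+ (l - i) by rewrite -exprD subnKC.
have Ek : P ^+ k = P ^+ i * P ^+ (l - i) * P ^+ (k - l).
  by rewrite -El -exprD subnKC // ltnW.
have rel1 : 4 * x * plB2 M =
    P ^+ (l - i) * (- (P ^+ (k - l) * (4 * c - 1) + plC1 M * mu)).
  apply: (mulfI (Pn0 i)); apply/eqP; rewrite -subr_eq0 -[X in _ == X]rel Ek El.
  by apply/eqP; ring.
(* For [i < l] the factor [4 * x] is prime to [P] and can be cancelled in [rel1]; for [i = l] the
   divisor is 1. *)
have /dvdzP[y B2] : (P ^+ (l - i) %| plB2 M)%Z.
  have [->|il'] := eqVneq i l; first by rewrite subnn dvd1z.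
  have Hx : ~~ (P %| x)%Z by apply: Px; rewrite ltn_neqAle il'.
  have co4x : coprimez (P ^+ (l - i)) (4 * x).
    by apply: P_coprime; rewrite P_Euclid negb_or P_4.
  by rewrite -(Gauss_dvdzr _ co4x) rel1 dvdz_mulr.
exists i, x, y, c; split=> //; apply: pl_dataI => //; by rewrite B2 mulrC.
Qed.

Lemma pl_data_bigS i x y c M : pl_data i x y c M -> bigS (P ^+ k) (mu * P ^+ l) M.
Proof. by case=> gM [A1 _ _] [A2 _ _]. Qed.

Lemma pl_data_exists i x y c : admissible i x y c -> exists M, pl_data i x y c M.
Proof.
case/and4P=> il Hx /implyP Hy /implyP Hc.
set C1 := - mu * (4 * (x * y) + P ^+ (k - l) * (4 * c - 1)).
have C14 : (C1 = -1 %[mod 4])%Z.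
  (* The congruence for [P ^+ (k - l)] is what makes [C1] equal to -1 modulo 4. *)
  have [t Et] : exists t, P ^+ (k - l) = 4 * t - mu.
    exact: (eq_mod4P _ _).1 p_mu.
  have -> : C1 = 4 * (- mu * (x * y) - mu * (t * (4 * c - 1)) + c) - 1.
    rewrite /C1 Et; have -> : - mu * (4 * (x * y) + (4 * t - mu) * (4 * c - 1)) =
      4 * (- mu * (x * y) - mu * (t * (4 * c - 1)) + (mu * mu) * c) - mu * mu by ring.
    by rewrite mumu mul1r.
  by apply/eq_mod4P; eexists; reflexivity.
have El : P ^+ l = P ^+ i * P ^+ (l - i) by rewrite -exprD subnKC.
have Ek : P ^+ k = P ^+ i * P ^+ (l - i) * P ^+ (k - l).
  by rewrite -El -exprD subnKC // ltnW.
have kl0 : (0 < k - l)%N by rewrite subn_gt0.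
have rel : P ^+ k * (4 * c - 1) + 4 * (P ^+ i * x) * (P ^+ (l - i) * y) + C1 * (mu * P ^+ l) = 0.
  have -> : C1 * (mu * P ^+ l) = - (mu * mu) * (P ^+ l * (4 * (x * y) + P ^+ (k - l) * (4 * c - 1))).
    by rewrite /C1; ring.
  by rewrite mumu Ek El; ring.
have C24 : (4 * c - 1 = -1 %[mod 4])%Z by apply/eq_mod4P; exists c.
(* For [i = 0] the coordinate [B_1 = x] is prime to [P]; for [i > 0], [C1] is, because [x] and [y]
   are. *)
have [x1 [y1 [z1 bz1]]] : exists x1 y1 z1,
    4 * P ^+ k * x1 + 4 * (P ^+ i * x) * y1 + C1 * z1 = 1.
  have [i0|i0] := posnP i.
    have /coprimezP[[u v] /= uv] := P_coprime x k Hx.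
    have [s [t st]] := odd_Bezout 1 C1 C14 (coprimen1 _).
    exists (u * s), (v * s), t.
    by rewrite i0 expr0 mul1r -[RHS]st -uv; ring.
  have [u [t ut]] : exists u t : int, 4 * P ^+ k * u + C1 * t = 1.
    apply: odd_Bezout => //; rewrite coprimez_sym; apply: P_coprime.
    rewrite P_Euclid negb_or rpredN; apply/andP; split.
      by case: mu1 => ->; rewrite ?rpredN.
    rewrite rpredDr; last by rewrite dvdz_mulr // P_exp.
    by rewrite !P_Euclid !negb_or P_4 Hx Hy.
  by exists u, 0, t; rewrite mulr0 addr0.
(* For [i < l] the coordinate [C_2] is prime to [P]; for [i = l], [B_2 = y] is prime to [P ^+ l]. *)
have [x2 [y2 [z2 bz2]]] : exists x2 y2 z2,
    4 * (mu * P ^+ l) * x2 + 4 * (P ^+ (l - i) * y) * y2 + (4 * c - 1) * z2 = 1.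
  have [il'|il'] := ltnP i l.
    have [u [t ut]] : exists u t : int, 4 * P ^+ l * u + (4 * c - 1) * t = 1.
      by apply: odd_Bezout => //; rewrite coprimez_sym; apply: P_coprime; apply: Hc.
    by exists (mu * u), 0, t; rewrite mulr0 addr0 -[RHS]ut -[u in RHS]mul1r -mumu; ring.
  have {il'} il' : i = l by apply/eqP; rewrite eqn_leq il.
  have [u [v uv]] : exists u v : int, u * P ^+ l + v * y = 1.
    have [l0|l0] := posnP l; first by exists 1, 0; rewrite l0 expr0 mul0r addr0.
    have /coprimezP[[u v] /= uv] : coprimez (P ^+ l) y.
      by apply: P_coprime; apply: Hy; rewrite il'.
    by exists u, v.
  have [s [t st]] := odd_Bezout 1 (4 * c - 1) C24 (coprimen1 _).
  exists (mu * u * s), (v * s), t.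
  rewrite il' subnn expr0 mul1r -[RHS]st -uv -[u * P ^+ l]mul1r -mumu; ring.
have [M [gM M1 M2]] := pl_surj _ _ _ _ _ _ _ _ _ _ _ _ rel C14 C24 bz1 bz2.
by exists M; split.
Qed.

(** Here [D = P ^+ l], so [A_2 / D = mu] is odd and the closed formula applies directly. The first,
    second and fourth factors are 1; reciprocity turns the last two into symbols of [- C_1] and
    [- C_2] modulo [p]. *)
Lemma splitting_pl_data i x y c M : admissible i x y c -> pl_data i x y c M ->
  splitting M = kronecker_prime x p ^+ (k - l)
                * kronecker_prime (mu * (x * y)) p ^+ i
                * kronecker_prime (1 - 4 * c) p ^+ (l - i).
Proof.
case/and4P=> il Hx /implyP Hy /implyP Hc [gM [A1 B1 C1] [A2 B2 C2]].
have [C14 C24] := Gamma_pl_mod4 M gM.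
have El : P ^+ l = P ^+ i * P ^+ (l - i) by rewrite -exprD subnKC.
have Ek : P ^+ k = P ^+ l * P ^+ (k - l) by rewrite -exprD subnKC // ltnW.
have absP n : `|P ^+ n|%N%:Z = P ^+ n by rewrite -PoszX absz_nat.
have ED : gcdz (P ^+ k) (mu * P ^+ l) = P ^+ l.
  have -> : gcdz (P ^+ k) (mu * P ^+ l) = gcdz (P ^+ k) (P ^+ l).
    by case: mu1 => ->; rewrite ?mul1r // mulN1r gcdzN.
  rewrite gcdzC -[RHS]absP /gcdz; congr Posz; apply/gcdn_idPl.
  by rewrite -dvdzE Ek dvdz_mulr.
have ED1 : gcdz (P ^+ l) (P ^+ i * x) = P ^+ i.
  by rewrite El -mulz_gcdr absP (eqP (P_coprime x _ Hx)) mulr1.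
have muq : (mu * P ^+ l %/ P ^+ l)%Z = mu by rewrite mulzK.
have x0 : x != 0 by apply: contraNneq Hx => ->; rewrite dvdz0.
rewrite /splitting A1 A2 ED muq.
have -> : odd `|mu| by case: mu1 => ->.
rewrite /splitting_odd A1 exprn_gt0 ?ltz_nat ?prime_gt0 // /splitting_formula.
rewrite A1 A2 B1 B2 C2 ED ED1 muq.
(* Only [eps = -1] matters. Since [k + l] and [k - l] differ by the even number [2 * l],
   [P ^+ (k + l)] is also [- mu] modulo 4. *)
have -> : kronecker (kronecker (-1) (P ^+ i * x %/ P ^+ i)%Z) (- (P ^+ k * (mu * P ^+ l))) = 1.
  rewrite mulKz //; case: (kronecker_N1_cases x x0) => ->; first exact: kronecker1l.
  rewrite mulrCA -exprD -PoszX; apply: (kronecker_N1_mod4 p) => //.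
  have -> : (k + l = k - l + l * 2)%N by rewrite muln2 -addnn addnA subnK // ltnW.
  rewrite PoszX exprD [(l * 2)%N]mulnC exprM -modzMmr -modzXm.
  have -> := odd_sqr_mod4 p p_odd.
  by rewrite modzXm expr1n modzMmr mulr1 -p_mu.
have -> : kronecker (P ^+ k %/ P ^+ l)%Z mu = 1.
  rewrite Ek mulKz //; case: mu1 => ->; rewrite /kronecker /=.
    by rewrite big_nil.
  by rewrite big_nil mulr1 ltNge exprn_ge0.
rewrite !mul1r.
have -> : (`|(mu * P ^+ l)%R| %/ P ^+ l)%Z = 1.
  by case: mu1 => ->; rewrite ?mul1r ?mulN1r ?normrN ger0_norm ?exprn_ge0 // divzz Pn0.
rewrite kronecker1r mulr1 mulKz //.
have -> : (P ^+ k %/ P ^+ l)%Z = P ^+ (k - l) by rewrite Ek mulKz.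
have -> : (P ^+ l %/ P ^+ i)%Z = P ^+ (l - i) by rewrite El mulKz.
rewrite -!PoszX kronecker_pfactor //.
rewrite !kronecker_reciprocity // -?C2 //; congr (_ * _ ^+ _ * _).
  rewrite C1.
  have -> : kronecker_prime (mu * (x * y)) p = kronecker_prime (4 * (mu * (x * y))) p.
    rewrite [RHS]kronecker_primeM // (_ : 4 = 2 ^+ 2) // kronecker_primeX //.
    by rewrite kronecker_prime_sqr ?mul1r //; apply: contra P_4 => /(dvdz_mull 2).
  apply: kronecker_prime_mod => //.
  have -> : - (- mu * (4 * (x * y) + P ^+ (k - l) * (4 * c - 1))) - 4 * (mu * (x * y)) =
    P ^+ (k - l) * (mu * (4 * c - 1)) by ring.
  by rewrite dvdz_mulr // P_exp // subn_gt0.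
by rewrite C2 opprB.
Qed.

Lemma pl_data_mull i x y c u M : Gamma_inf u -> pl_data i x y c M ->
  pl_data i x y c (u *m M).
Proof.
move=> gu [gM M1 M2]; have [[A1 B1 C1] [A2 B2 C2]] := pl_mull u M gu.
by split; rewrite ?A1 ?B1 ?C1 ?A2 ?B2 ?C2 //; exact: Gamma_mull.
Qed.

(** This yields the moduli [P ^+ (k - i)], [P ^+ i] and [P ^+ l] for [x], [y] and [c]. Moving [x]
    also moves [c], by the term in [P ^+ (l - i) * y]. *)
Lemma pl_data_mulr i x y c v M : (i <= l)%N -> Gamma_inf v -> pl_data i x y c M ->
  pl_data i (x + v 0 1 * P ^+ (k - i)) (y - mu * v 1 2 * P ^+ i)
    (c - v 0 1 * (P ^+ (l - i) * y) + mu * (v 0 1 * v 1 2 - v 0 2) * P ^+ l) (M *m v).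
Proof.
move=> il gv [gM [A1 B1 C1] [A2 B2 C2]].
have [[vA1 vB1 vC1] [vA2 vB2 vC2]] := pl_mulr M v gv gM.
have El : P ^+ l = P ^+ i * P ^+ (l - i) by rewrite -exprD subnKC.
have Ek : P ^+ k = P ^+ i * P ^+ (k - i) by rewrite -exprD subnKC // (leq_trans il) // ltnW.
apply: pl_dataI => //; first exact: Gamma_mulr.
- by rewrite vA1.
- by rewrite vB1 A1 B1 Ek; ring.
- by rewrite vA2.
- by rewrite vB2 A2 B2 El; ring.
- by rewrite vC2 A2 B2 C2; ring.
Qed.

Lemma pl_data_dcoset i x y c M N : pl_data i x y c M -> pl_data i x y c N ->
  dcoset M = dcoset N.
Proof.
move=> [gM [A1 B1 C1] [A2 B2 C2]] [gN [A1' B1' C1'] [A2' B2' C2']].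
have [||u gu ->] := pl_inj M N gM gN.
- by rewrite A1 B1 C1 A1' B1' C1'.
- by rewrite A2 B2 C2 A2' B2' C2'.
apply/esym/dcoset_eq; exists u, 1%:M; rewrite mulmx1; split=> //; exact: Gamma_inf1.
Qed.

(** As [x] is prime to [P], [i] is the exact valuation of [B_1]. *)
Lemma pl_data_inj i x y c i' x' y' c' M : (i <= l)%N -> (i' <= l)%N ->
  pl_data i x y c M -> pl_data i' x' y' c' M -> [/\ i = i', x = x', y = y' & c = c'].
Proof.
move=> il il' dM dM'.
have /and4P[_ Hx _ _] := pl_data_admissible _ _ _ _ _ il dM.
have /and4P[_ Hx' _ _] := pl_data_admissible _ _ _ _ _ il' dM'.
case: dM dM' => gM [_ B1 _] [_ B2 C2] [_ [_ B1' _] [_ B2' C2']].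
have aux a b z z' : (a < b)%N -> P ^+ a * z = P ^+ b * z' -> (P %| z)%Z.
  move=> ab; rewrite -(subnKC (ltnW ab)) exprD -mulrA => /(mulfI (Pn0 a)) ->.
  by rewrite dvdz_mulr // P_exp // subn_gt0.
have ii' : i = i'.
  have [lt_ii'|lt_i'i|//] := ltngtP i i'.
    by case/negP: Hx; apply: (aux _ _ _ _ lt_ii'); rewrite -B1 B1'.
  by case/negP: Hx'; apply: (aux _ _ _ _ lt_i'i); rewrite -B1' B1.
rewrite -{}ii' in B1' B2' *; split=> //.
- by apply: (mulfI (Pn0 i)); rewrite -B1 -B1'.
- by apply: (mulfI (Pn0 (l - i))); rewrite -B2 -B2'.
- have /(congr1 (+%R^~ 1)) : 4 * c - 1 = 4 * c' - 1 by rewrite -C2 -C2'.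
  by rewrite !subrK => /mulfI ->.
Qed.

Lemma Gamma_inf_mx3 (a b c : int) : Gamma_inf (mx3 1 a c 0 1 b 0 0 1).
Proof. by apply/Gamma_infP; rewrite !mx3E. Qed.

Lemma pl_data_reduce i x y c M : (i <= l)%N -> pl_data i x y c M ->
  exists (x' : 'I_(p ^ (k - i))) (y' : 'I_(p ^ i)) (c' : 'I_(p ^ l)) (v : 'M[int]_3),
    Gamma_inf v /\ pl_data i x' y' c' (M *m v).
Proof.
move=> il dM.
have reduce (n : nat) (a : int) : exists (b : 'I_(p ^ n)) (q : int), a = q * P ^+ n + b%:Z.
  have lt_b : (`|(a %% P ^+ n)%Z| < p ^ n)%N.
    by rewrite -ltz_nat PoszX gez0_abs ?modz_ge0 // ltz_pmod // exprn_gt0 // ltz_nat prime_gt0.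
  exists (Ordinal lt_b), (a %/ P ^+ n)%Z; rewrite /= gez0_abs ?modz_ge0 //.
  exact: divz_eq.
have [x' [qx Ex]] := reduce (k - i)%N x.
have [y' [qy Ey]] := reduce i y.
(* This is [c] after the moves that reduce [x] and [y]. The factors [mu] in [v] undo the sign of
   [A_2]. *)
have [c' [qc Ec]] := reduce l (c + qx * (P ^+ (l - i) * y) - mu * (qx * (mu * qy)) * P ^+ l).
pose v := mx3 1 (- qx) (mu * qc) 0 1 (mu * qy) 0 0 1.
exists x', y', c', v; split; first exact: Gamma_inf_mx3.
have := pl_data_mulr _ _ _ _ v _ il (Gamma_inf_mx3 _ _ _) dM.
rewrite !mx3E.
have -> : x + - qx * P ^+ (k - i) = x' by rewrite Ex; ring.
have -> : y - mu * (mu * qy) * P ^+ i = y' by rewrite mulrA mumu Ey; ring.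
have -> // : c - - qx * (P ^+ (l - i) * y) + mu * (- qx * (mu * qy) - mu * qc) * P ^+ l = c'.
apply: (addrI (qc * P ^+ l)); rewrite -Ec -{1}[qc]mul1r -mumu; ring.
Qed.

Lemma residue_shift (N a b t : int) :
  0 <= a < N -> 0 <= b < N -> b = a + t * N -> t = 0.
Proof. by clear; move=> *; nia. Qed.

(** Comparing [x], then [y], then [c] forces the entries [v 0 1], [v 1 2], [v 0 2] to vanish in this
    order: the cross terms in [c] are gone once the first two are 0. *)
Lemma pl_data_dcoset_inj i x y c i' x' y' c' M N : (i <= l)%N -> (i' <= l)%N ->
  pl_data i x y c M -> pl_data i' x' y' c' N -> dcoset M N ->
  0 <= x < P ^+ (k - i) -> 0 <= y < P ^+ i -> 0 <= c < P ^+ l ->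
  0 <= x' < P ^+ (k - i') -> 0 <= y' < P ^+ i' -> 0 <= c' < P ^+ l ->
  [/\ i = i', x = x', y = y' & c = c'].
Proof.
move=> il il' dM dN [u [v [gu gv EN]]] bx by_ bc bx' by' bc'.
have := pl_data_mulr _ _ _ _ v _ il gv (pl_data_mull _ _ _ _ u _ gu dM).
rewrite -EN => dN'; have [ii' xx' yy' cc'] := pl_data_inj _ _ _ _ _ _ _ _ _ il il' dN' dN.
rewrite -ii' in bx' by' *.
have v01 : v 0 1 = 0 by apply: residue_shift bx bx' _; rewrite xx'.
have v12 : - (mu * v 1 2) = 0 by apply: residue_shift by_ by' _; rewrite -yy'; ring.
have v12' : v 1 2 = 0 by rewrite -[LHS]mul1r -mumu -mulrA -[mu * v 1 2]opprK v12 oppr0 mulr0.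
have v02 : - (mu * v 0 2) = 0.
  by apply: residue_shift bc bc' _; rewrite -cc' v01 v12'; ring.
split=> //.
- by rewrite -xx' v01; ring.
- by rewrite -yy' v12'; ring.
- by rewrite -cc' v01 v12' mul0r sub0r mulrN v02; ring.
Qed.

Definition pl_rep (i : nat) (x y c : int) : 'M[int]_3 :=
  xget 1%:M [set M | pl_data i x y c M]%classic.

Lemma pl_repP i x y c : admissible i x y c -> pl_data i x y c (pl_rep i x y c).
Proof.
case/pl_data_exists => M dM.
exact: (@xgetPex _ 1%:M [set N | pl_data i x y c N]%classic (ex_intro _ M dM)).
Qed.

Lemma fsbig_dcoset (V : nmodType) (F : set 'M[int]_3 -> V) :
  \sum_(X \in [set dcoset M | M in bigS (P ^+ k) (mu * P ^+ l)]%classic) F X =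
  \sum_(i < l.+1) \sum_(x < p ^ (k - i)) \sum_(y < p ^ i) \sum_(c < p ^ l)
    if admissible i x y c then F (dcoset (pl_rep i x y c)) else 0.
Proof.
(* A dependent index type is used since the ranges of [x] and [y] vary with [i]. *)
pose J (i : 'I_l.+1) : finType := ('I_(p ^ (k - i)) * ('I_(p ^ i) * 'I_(p ^ l)))%type.
pose adm (t : {i : 'I_l.+1 & J i}) :=
  admissible (tag t) (tagged t).1 (tagged t).2.1 (tagged t).2.2.
pose h (t : {i : 'I_l.+1 & J i}) :=
  dcoset (pl_rep (tag t) (tagged t).1 (tagged t).2.1 (tagged t).2.2).
have rng (n : nat) (z : 'I_(p ^ n)) : 0 <= z%:Z < P ^+ n.
  by rewrite -PoszX ltz_nat ltn_ord.
have bij : set_bij [set` adm] [set dcoset M | M in bigS (P ^+ k) (mu * P ^+ l)]%classic h.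
  split.
  - move=> t /= /pl_repP dM; exists (pl_rep (tag t) (tagged t).1 (tagged t).2.1 (tagged t).2.2) => //.
    exact: pl_data_bigS dM.
  - move=> [i [x [y c]]] [i' [x' [y' c']]]; rewrite !inE /adm /h /= => adm1 adm2 E.
    have := pl_data_dcoset_inj _ _ _ _ _ _ _ _ _ _ (ltn_ord i) (ltn_ord i') (pl_repP _ _ _ _ adm1)
      (pl_repP _ _ _ _ adm2).
    rewrite E => /(_ (dcoset_refl _) (rng _ _) (rng _ _) (rng _ _) (rng _ _) (rng _ _) (rng _ _)).
    case=> /val_inj ii'; case: _ / ii' x' y' c' adm2 E => x' y' c' _ _.
    by case=> /val_inj -> [] /val_inj -> [] /val_inj ->.
  - move=> _ [M sM <-]; have [i [x [y [c [il dM]]]]] := bigS_pl_data M sM.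
    have [x' [y' [c' [v [gv dMv]]]]] := pl_data_reduce _ _ _ _ _ il dM.
    pose t : {i : 'I_l.+1 & J i} := Tagged J ((x', (y', c')) : J (Ordinal (il : (i < l.+1)%N))).
    have admt : adm t by apply: pl_data_admissible dMv.
    exists t => //; rewrite /h /=.
    rewrite (pl_data_dcoset _ _ _ _ _ _ (pl_repP _ _ _ _ admt) dMv).
    apply: dcoset_eq; exists 1%:M, v; rewrite mul1mx; split=> //; exact: Gamma_inf1.
rewrite (reindex_fsbig h [set` adm]) // -(bigfs _ (index_enum_uniq _)) => [|t _]; last first.
  by rewrite mem_index_enum.
rewrite big_mkcond -(@sig_big_dep _ _ _ _ J xpredT (fun _ _ => true)
  (fun i (u : J i) => if admissible i u.1 u.2.1 u.2.2 then
     F (dcoset (pl_rep i u.1 u.2.1 u.2.2)) else 0)) /=.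
by apply: eq_bigr => i _; under [RHS]eq_bigr do rewrite pair_bigA; rewrite pair_bigA.
Qed.

Section Summand.
Variables (R : realType) (m1 m2 : int).

(** The fraction [B_2 / A_2] is written [mu * y / p ^ i], as [mu] is its own inverse. *)
Definition Sigma_summand (i : nat) (x y c : int) : R[i] :=
  (kronecker_prime x p ^+ (k - l) * kronecker_prime (mu * (x * y)) p ^+ i
   * kronecker_prime (1 - 4 * c) p ^+ (l - i))%:~R
  * expi2pi ((m1 * x)%:~R / (p ^ (k - i))%:R + (m2 * (mu * y))%:~R / (p ^ i)%:R : R).

Lemma Sigma_term_pl_data i x y c M : (i <= l)%N -> pl_data i x y c M ->
  Sigma_term R m1 m2 M = Sigma_summand i x y c.
Proof.
move=> il dM; rewrite /Sigma_term (splitting_pl_data _ _ _ _ _ (pl_data_admissible _ _ _ _ _ il dM) dM).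
have fracK (a b d : int) : a != 0 -> (a * b)%:~R / (a * d)%:~R = b%:~R / d%:~R :> R.
  by move=> a0; rewrite !intrM -mulf_div divff ?intr_eq0 // mul1r.
have mu0 : mu != 0 by case: mu1 => ->.
case: dM => gM [A1 B1 _] [A2 B2 _]; rewrite A1 B1 A2 B2; congr (_ * expi2pi (_ + _)).
  have -> : P ^+ k = P ^+ i * P ^+ (k - i) by rewrite -exprD subnKC // (leq_trans il) // ltnW.
  by rewrite fracK // mulrA -intrM -PoszX.
have -> : P ^+ l = P ^+ (l - i) * P ^+ i by rewrite -exprD subnK.
rewrite [mu * (_ * _)]mulrCA fracK // -[y in LHS]mul1r -mumu -mulrA fracK //.
by rewrite mulrA -intrM -PoszX.
Qed.

(** Independence of the representative, needed because [xget] picks an arbitrary one: the symbols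
    with a positive exponent see only residues modulo [p], and the phase changes by an integer. *)
Lemma Sigma_term_dcoset i x y c M N : (i <= l)%N -> pl_data i x y c M ->
  dcoset M N -> Sigma_term R m1 m2 N = Sigma_summand i x y c.
Proof.
move=> il dM [u [v [gu gv ->]]].
rewrite (Sigma_term_pl_data _ _ _ _ _ il
  (pl_data_mulr _ _ _ _ v _ il gv (pl_data_mull _ _ _ _ u _ gu dM))).
have ki0 : (0 < k - i)%N by rewrite subn_gt0 (leq_ltn_trans il).
rewrite /Sigma_summand; congr (_%:~R * _).
  congr (_ ^+ _ * _ * _).
  - by apply: kronecker_prime_mod; rewrite // addrC addKr dvdz_mull // P_exp.
  (* For [i = 0] the shift of [y] need not be divisible by [P], but then the exponent is 0. *)
  - have [->|i0] := posnP i; first by rewrite !expr0.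
    congr (_ ^+ _); apply: kronecker_prime_mod => //.
    have -> : forall a b s t : int, mu * ((x + a * s) * (y - b * t)) - mu * (x * y) =
      s * (mu * a * (y - b * t)) + t * (- mu * x * b) by move=> *; ring.
    by rewrite rpredD // dvdz_mulr // P_exp.
  - have [->|li0] := posnP (l - i); first by rewrite !expr0.
    congr (_ ^+ _); apply: kronecker_prime_mod => //.
    have l0 : (0 < l)%N by apply: leq_trans li0 _; exact: leq_subr.
    have -> : forall a b s t : int, 1 - 4 * (c - a * (s * y) + b * t) - (1 - 4 * c) =
      s * (4 * a * y) + t * (- 4 * b) by move=> *; ring.
    by rewrite rpredD // dvdz_mulr // P_exp.
apply: (expi2pi_shift _ _ _ (m1 * v 0 1 - m2 * v 1 2)).
have pn0 n : (p ^ n)%:R != 0 :> R by rewrite pnatr_eq0 -lt0n expn_gt0 prime_gt0.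
set z := v 0 1; set t := v 1 2.
have -> : m1 * (x + z * P ^+ (k - i)) = m1 * x + m1 * z * P ^+ (k - i) by ring.
have -> : m2 * (mu * (y - mu * t * P ^+ i)) = m2 * (mu * y) - m2 * t * (mu * mu) * P ^+ i by ring.
have cancel_pn n (a : int) : (a * P ^+ n)%:~R / (p ^ n)%:R = a%:~R :> R.
  by rewrite -PoszX intrM -pmulrn mulfK.
rewrite mumu mulr1 [in LHS]intrD [in LHS]intrB mulrDl mulrBl !cancel_pn [in RHS]intrB; ring.
Qed.

(** Each violated condition puts a vanishing symbol under a positive exponent. The sums may thus run
    over full residue systems, which makes them factor. *)
Lemma Sigma_summand_inadmissible i x y c : (i <= l)%N -> ~~ admissible i x y c ->
  Sigma_summand i x y c = 0.
Proof.
move=> il; rewrite /admissible il /= !negb_and !negb_imply /= !andbT.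
have chi0 (a : int) n : (0 < n)%N -> (P %| a)%Z -> kronecker_prime a p ^+ n = 0.
  by move=> n0; rewrite -kronecker_prime_eq0 => /eqP ->; rewrite expr0n gtn_eqF.
rewrite /Sigma_summand => /or3P[Hx|/andP[i0 Hy]|/andP[il' Hc]].
- by rewrite (chi0 x) ?subn_gt0 // !mul0r.
- by rewrite (chi0 (mu * (x * y)) i) ?mulr0 ?mul0r // !dvdz_mull.
- by rewrite (chi0 (1 - 4 * c)) ?subn_gt0 // ?mulr0 ?mul0r // -opprB rpredN.
Qed.

Lemma Sigma_sum : Sigma R (P ^+ k) (mu * P ^+ l) m1 m2 =
  \sum_(i < l.+1) \sum_(x < p ^ (k - i)) \sum_(y < p ^ i) \sum_(c < p ^ l)
    Sigma_summand i x y c.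
Proof.
rewrite /Sigma fsbig_dcoset; apply: eq_bigr => i _; apply: eq_bigr => x _.
apply: eq_bigr => y _; apply: eq_bigr => c _.
have il : (i <= l)%N := ltn_ord i.
case: ifPn => [adm|/Sigma_summand_inadmissible -> //].
have dM := pl_repP _ _ _ _ adm.
apply: (Sigma_term_dcoset _ _ _ _ _ _ il dM).
exact: (@xgetPex _ 1%:M (dcoset _) (ex_intro _ _ (dcoset_refl _))).
Qed.
End Summand.

End PrimePowerCosets.

(** * Gauss sums modulo powers of [p] *)

Section PrimePowerGaussSums.
Variables (R : realType) (p : nat).
Hypotheses (p_pr : prime p) (p_odd : odd p).

Local Notation P := (p%:Z).
Local Notation chi a := (kronecker_prime a p).

Lemma gauss_sum_pfactor (m : int) (n : nat) :
  gauss_sum R (p ^ n)%N%:Z m (p ^ n)%N =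
  \sum_(x < p ^ n) (chi x%:Z ^+ n)%:~R * expi2pi ((m * x%:Z)%:~R / (p ^ n)%:R : R).
Proof.
rewrite /gauss_sum big_mkcond; apply: eq_bigr => x _; rewrite kronecker_pfactor //.
case: ifP => // /negbT cop.
have n0 : (0 < n)%N by case: n x cop => // x; rewrite coprimen1.
have /eqP -> : chi x%:Z == 0.
  move: cop; rewrite coprime_pexpr // coprime_sym prime_coprime // negbK.
  by rewrite kronecker_prime_eq0.
by rewrite expr0n gtn_eqF // mul0r.
Qed.

Lemma dvdz_pfactor_kronecker (n : nat) (a b : int) : (0 < n)%N ->
  (P ^+ n %| a - b)%Z -> chi a = chi b.
Proof.
move=> n0 ab; apply: kronecker_prime_mod => //.
by apply: dvdz_trans ab; rewrite dvdz_exp.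
Qed.

Lemma expi2pi_periodic (n : nat) (m x y : int) : (0 < n)%N -> (n%:Z %| x - y)%Z ->
  expi2pi ((m * x)%:~R / n%:R : R) = expi2pi ((m * y)%:~R / n%:R : R).
Proof.
move=> n0 /dvdzP[q xy]; apply: (expi2pi_shift _ _ _ (m * q)).
rewrite -mulrBl -intrB -mulrBr xy mulrA [X in X / _]intrM -pmulrn mulfK //.
by rewrite pnatr_eq0 -lt0n.
Qed.

(** Scaling by a nonresidue changes the sign of every term. *)
Lemma sum_kronecker_prime_odd (n : nat) : odd n -> \sum_(x < p ^ n) chi x%:Z ^+ n = 0.
Proof.
move=> n_odd; have n0 : (0 < n)%N by case: n n_odd.
have [a Ea] := kronecker_prime_nonresidue p p_pr p_odd.
suff : \sum_(x < p ^ n) chi x%:Z ^+ n = - \sum_(x < p ^ n) chi x%:Z ^+ n by clear; lia.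
rewrite -{1}(sum_affine _ (p ^ n) a 0 (fun z => chi z ^+ n)).
- rewrite -sumrN; apply: eq_bigr => x _.
  by rewrite addr0 kronecker_primeM // Ea mulN1r exprNn -signr_odd n_odd mulN1r.
- by rewrite expn_gt0 prime_gt0.
- rewrite coprimez_sym PoszX coprimezXl // coprimezE prime_coprime //.
  by rewrite -[in p]/(`|p%:Z|%N) -dvdzE -kronecker_prime_eq0 Ea.
- by move=> x y xy; rewrite (@dvdz_pfactor_kronecker n x y) // -PoszX.
Qed.

Lemma gauss_sum_principal (j : nat) :
  gauss_sum R (p ^ j)%N%:Z (p ^ j)%N%:Z (p ^ j)%N = (\sum_(x < p ^ j) chi x%:Z ^+ j)%:~R.
Proof.
rewrite gauss_sum_pfactor rmorph_sum; apply: eq_bigr => x _.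
have pj0 : (p ^ j)%:R != 0 :> R by rewrite pnatr_eq0 -lt0n expn_gt0 prime_gt0.
by rewrite [_%:Z * _]mulrC intrM (mulfK pj0) expi2pi_int mulr1.
Qed.

(* [1 - 4 * c] runs through all residues, since 4 is prime to [p]. *)
Lemma sum_kronecker_affine (i j : nat) :
  \sum_(c < p ^ (i + j)) chi (1 - 4 * c%:Z) ^+ j = (\sum_(x < p ^ j) chi x%:Z ^+ j) *+ p ^ i.
Proof.
have fP n (x y : int) : (0 < n)%N -> (P ^+ n %| x - y)%Z -> chi x ^+ j = chi y ^+ j.
  by move=> n0 xy; rewrite (@dvdz_pfactor_kronecker n x y).
transitivity (\sum_(c < p ^ (i + j)) chi (-4 * c%:Z + 1) ^+ j).
  by apply: eq_bigr => c _; rewrite mulNr addrC.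
have [->|j0] := posnP j.
  rewrite addn0 expn0 big_ord1 expr0 -[(p ^ i)%N in RHS]card_ord -sumr_const.
  by apply: eq_bigr => c _; rewrite expr0.
rewrite (sum_affine _ (p ^ (i + j)) (-4) 1 (fun z => chi z ^+ j)).
- rewrite addnC expnD (sum_periodic _ _ _ (fun z => chi z ^+ j)) // => x y.
  by rewrite PoszX; apply: fP.
- by rewrite expn_gt0 prime_gt0.
- rewrite coprimez_sym PoszX coprimezXl // coprimezE prime_coprime //.
  by rewrite (_ : `|(-4)%R|%N = (2 ^ 2)%N) // Euclid_dvdX // dvdn_prime2 // andbT; apply: contraTneq p_odd => p2;
  rewrite -[p]/(`|P|%N) p2.
- by move=> x y; rewrite PoszX; apply: fP; rewrite addn_gt0 j0 orbT.
Qed.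

Lemma sum_twist_sign (mu m : int) (i : nat) : mu = 1 \/ mu = -1 ->
  \sum_(y < p ^ i) (chi (mu * y%:Z) ^+ i)%:~R
    * expi2pi ((m * (mu * y%:Z))%:~R / (p ^ i)%:R : R) =
  gauss_sum R (p ^ i)%N%:Z m (p ^ i)%N.
Proof.
move=> mu1; have pi0 : (0 < p ^ i)%N by rewrite expn_gt0 prime_gt0.
rewrite gauss_sum_pfactor -[RHS](sum_affine _ _ mu 0
  (fun z => (chi z ^+ i)%:~R * expi2pi ((m * z)%:~R / (p ^ i)%:R))) //.
- by apply: eq_bigr => y _; rewrite addr0.
- by case: mu1 => ->; rewrite coprimezE coprime1n.
- move=> x y xy; rewrite (expi2pi_periodic _ m x y) //; congr (_%:~R * _).
  have [->|i0] := posnP i; first by rewrite !expr0.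
  by rewrite (@dvdz_pfactor_kronecker i x y) // -PoszX.
Qed.

(** Cancelling [p ^ i] in the phase leaves a summand of period [p ^ (k - i)]; [i < k] ensures that
    the symbol has this period too. *)
Lemma gauss_sum_lift (k i r : nat) : (i < k)%N ->
  gauss_sum R (p ^ k)%N%:Z (p ^ (r + i))%N%:Z (p ^ k)%N =
  (\sum_(x < p ^ (k - i)) (chi x%:Z ^+ k)%:~R
    * expi2pi (((p ^ r)%N%:Z * x%:Z)%:~R / (p ^ (k - i))%:R : R)) *+ p ^ i.
Proof.
move=> ik; have pn0 n : (0 < p ^ n)%N by rewrite expn_gt0 prime_gt0.
rewrite -[RHS](sum_periodic _ _ _ (fun z => (chi z ^+ k)%:~R
    * expi2pi (((p ^ r)%N%:Z * z)%:~R / (p ^ (k - i))%:R))).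
  rewrite -expnD subnK ?(ltnW ik) // gauss_sum_pfactor; apply: eq_bigr => x _.
  congr (_ * expi2pi _).
  have -> : (p ^ k)%:R = (p ^ (k - i))%:R * (p ^ i)%:R :> R.
    by rewrite -natrM -expnD subnK // ltnW.
  have -> : (p ^ (r + i))%N%:Z * x%:Z = (p ^ r)%N%:Z * x%:Z * (p ^ i)%N%:Z.
    by rewrite expnD PoszM mulrAC.
  rewrite [in LHS]intrM -[LHS]mulf_div [X in _ * X]divff ?mulr1 //.
  by rewrite pnatr_eq0 -lt0n.
move=> x y xy; rewrite (expi2pi_periodic _ _ x y) //; congr (_%:~R * _).
by rewrite (@dvdz_pfactor_kronecker (k - i) x y) ?subn_gt0 // -PoszX.
Qed.

End PrimePowerGaussSums.

(** * Assembly of the three factors *)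

Theorem proposition32 (R : realType) (p : nat) (mu : int) (k l r1 r2 : nat)
  (p_prime : prime p) (p_odd : odd p)
  (mu_sign : mu = 1 \/ mu = -1)
  (l_lt_k : (l < k)%N) (l_gt0 : (0 < l)%N)
  (p_mu : ((p ^ (k - l))%N%:Z = - mu %[mod 4])%Z) :
  Sigma R (p ^ k)%N%:Z (mu * (p ^ l)%N%:Z) (p ^ r1)%N%:Z (p ^ r2)%N%:Z =
  \sum_(i < l.+1)
    gauss_sum R (p ^ i)%N%:Z (p ^ i)%N%:Z (p ^ i)%N
    * gauss_sum R (p ^ (l - i))%N%:Z (p ^ r2)%N%:Z (p ^ (l - i))%N
    * gauss_sum R (p ^ k)%N%:Z (p ^ (r1 + l - i))%N%:Z (p ^ k)%N.
Proof.
have SigmaE := Sigma_sum p mu k l p_prime p_odd mu_sign l_lt_k.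
rewrite -!PoszX in SigmaE; rewrite SigmaE //.
(* The index of the Gauss sums is the exponent of [D_2], whereas the cosets are indexed by that of
   [D_1]; hence the reversal. *)
rewrite [RHS](reindex_inj rev_ord_inj) /=; apply: eq_bigr => i _; rewrite subSS.
have il : (i <= l)%N := ltn_ord i.
have ik : (i < k)%N := leq_ltn_trans il l_lt_k.
set j := (l - i)%N.
have -> : (l - j = i)%N by rewrite /j subKn.
have -> : (r1 + l - j = r1 + i)%N by rewrite /j subnBA // addnAC addnK.
have El : l = (i + j)%N by rewrite /j subnKC.
pose a (x : nat) : R[i] := (kronecker_prime x%:Z p ^+ (k - l + i))%:~R
  * expi2pi (((p ^ r1)%N%:Z * x%:Z)%:~R / (p ^ (k - i))%:R : R).
pose b (y : nat) : R[i] := (kronecker_prime (mu * y%:Z) p ^+ i)%:~R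
  * expi2pi (((p ^ r2)%N%:Z * (mu * y%:Z))%:~R / (p ^ i)%:R : R).
pose d (c : nat) : R[i] := (kronecker_prime (1 - 4 * c%:Z) p ^+ j)%:~R.
transitivity ((\sum_(x < p ^ (k - i)) a x) * ((\sum_(y < p ^ i) b y) * \sum_(c < p ^ l) d c)).
  rewrite mulr_suml; apply: eq_bigr => x _; rewrite mulr_suml mulr_sumr; apply: eq_bigr => y _.
  rewrite !mulr_sumr; apply: eq_bigr => c _.
  rewrite /Sigma_summand /a /b /d expi2piD [mu * (_ * _)]mulrCA (kronecker_primeM p x) //.
  rewrite exprMn exprD !intrM.
  ring.
rewrite sum_twist_sign //.
have -> : \sum_(c < p ^ l) d c = gauss_sum R (p ^ j)%N%:Z (p ^ j)%N%:Z (p ^ j)%N *+ p ^ i.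
  by rewrite gauss_sum_principal // -rmorphMn -sum_kronecker_affine // -El rmorph_sum.
rewrite gauss_sum_lift // gauss_sum_principal // mulrnAr mulrnAr mulrnAr; congr (_ *+ _).
(* For odd [j] both sides contain the vanishing sum. For even [j] the power [j] of the symbol is 1
   on units, and nonunits vanish on both sides as both exponents are positive. *)
have [j_odd|j_even] := boolP (odd j).
  by rewrite sum_kronecker_prime_odd // !(mulr0z, mulr0, mul0r).
rewrite [_ * gauss_sum _ _ _ _]mulrC [RHS]mulrC; congr (_ * _).
apply: eq_bigr => x _; rewrite /a; congr (_%:~R * _).
have -> : kronecker_prime x%:Z p ^+ k =
    kronecker_prime x%:Z p ^+ (k - l + i) * kronecker_prime x%:Z p ^+ j.
  by rewrite -exprD -addnA -El subnK // ltnW.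
have e0 : (0 < k - l + i)%N by rewrite addn_gt0 subn_gt0 l_lt_k.
have [Hx|Hx] := boolP (p%:Z %| x%:Z)%Z.
  have /eqP -> : kronecker_prime x%:Z p == 0 by rewrite kronecker_prime_eq0.
  by rewrite expr0n gtn_eqF // mul0r.
by rewrite -[in RHS](even_halfK j_even) -muln2 mulnC exprM kronecker_prime_sqr // expr1n mulr1.
Qed.
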